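(* Let $(x_i)_{i=1}^\infty$ be a normalized basic sequence in a Banach space $X$. There exists a (not necessarily normalized) block basic sequence $(y_i)_{i=1}^\infty$ of $(x_i)$ such that all NCCB basic sequences of $(y_i)$ are good sequences and all such sequences have spreading models which are $1$-equivalent to one another.
   Context: Scalars are real; bases and basic sequences are Schauder. A block basic sequence of $(x_i)$ is a sequence of nonzero finitely supported vectors $y_j$ in the span of $(x_i)$ with $\max\operatorname{supp}(y_j)<\min\operatorname{supp}(y_{j+1})$, supports being taken with respect to $(x_i)$. NCCB basic sequence: for finite nonempty $E,F\subset\mathbb{N}$ write $E<F$ if $\max E<\min F$. A sequence $(z_i)_{i=1}^\infty$ is a normalized constant coefficient block basic sequence (NCCB basic sequence) of a basic sequence $(y_i)$ if there are finite nonempty sets $E_1<E_2<\cdots$ of natural numbers such that $z_i=\frac{\sum_{k\in E_i}y_k}{\|\sum_{k\in E_i}y_k\|}$ for all $i$. Good sequence: a normalized basic sequence $(z_i)$ is good if for every $n\in\mathbb{N}$ and all scalars $(a_i)_{i=1}^n$ the limit $\lim_{k_1\to\infty}\|\sum_{i=1}^n a_i z_{k_i}\|$ (over $k_1<k_2<\cdots<k_n$) exists; equivalently, $(z_i)$ generates a spreading model. Spreading model: a basic sequence is $1$-spreading if it is $1$-equivalent to all of its subsequences. A normalized $1$-spreading basis $(e_i)$ of a Banach space $(E,\|\cdot\|_s)$ is the spreading model generated by a normalized basic sequence $(z_i)$ if for all $\epsilon>0$ and $n\in\mathbb{N}$ there is $N\in\mathbb{N}$ such that $\big|\,\|\sum_{i=1}^n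 a_i z_{k_i}\|-\|\sum_{i=1}^n a_i e_i\|_s\big|\leq\epsilon$ for all $(a_i)_{i=1}^n\in[-1,1]^n$ and all $N\leq k_1<\cdots<k_n$. Sequences $(u_i)$, $(v_i)$ are $1$-equivalent if $\|\sum a_i u_i\|=\|\sum a_i v_i\|$ for all finitely supported scalars $(a_i)$. *)

(* Defs.v *)
From HB Require Import structures.
From mathcomp Require Import all_boot all_order all_algebra finmap.
From mathcomp Require Import all_classical all_reals all_analysis.

Set Implicit Arguments.
Unset Strict Implicit.
Unset Printing Implicit Defensive.

Import Order.TTheory GRing.Theory Num.Theory.
Import numFieldNormedType.Exports.

Local Open Scope classical_set_scope.
Local Open Scope ring_scope.

(* Sequences are indexed from 0, and a completeNormedModType over a realType
   plays the role of a real Banach space. *)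

Definition lincomb (R : realType) (E : completeNormedModType R)
    (u : nat -> E) (a : {fsfun nat -> R with 0}) : E :=
  \sum_(k <- finsupp a) a k *: u k.

Definition lin_span (R : realType) (E : completeNormedModType R)
    (u : nat -> E) : set E := range (lincomb u).

Definition schauder_basis_of (R : realType) (E : completeNormedModType R)
    (V : set E) (u : nat -> E) : Prop :=
  (forall i, V (u i)) /\
  (forall v, V v ->
     exists! a : nat -> R, series (fun i => a i *: u i) @ \oo --> v).

Definition basic_sequence (R : realType) (E : completeNormedModType R)
    (u : nat -> E) : Prop := schauder_basis_of (closure (lin_span u)) u.

Definition normalized (R : realType) (E : completeNormedModType R)
    (u : nat -> E) : Prop := forall i, `|u i| = 1.

(* For nonempty A and B this says max A < min B. *)
Definition fset_before (A B : {fset nat}) : Prop :=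
  forall i j, i \in A -> j \in B -> (i < j)%N.

(* When x is basic, c j is determined by y j, so finsupp (c j) is the support
   of y j with respect to x; it is nonempty because y j != 0. *)
Definition block_basic_sequence (R : realType) (X : completeNormedModType R)
    (x y : nat -> X) : Prop :=
  exists c : nat -> {fsfun nat -> R with 0},
    [/\ forall j, y j = lincomb x (c j),
        forall j, y j != 0
      & forall j, fset_before (finsupp (c j)) (finsupp (c j.+1))].

Definition nccb (R : realType) (X : completeNormedModType R)
    (y z : nat -> X) : Prop :=
  exists A : nat -> {fset nat},
    [/\ forall i, A i != fset0,
        forall i, fset_before (A i) (A i.+1)
      & forall i, z i = `|\sum_(k <- A i) y k|^-1 *: \sum_(k <- A i) y k].

Definition increasing_from (N n : nat) (k : 'I_n -> nat) : Prop :=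
  (forall i, (N <= k i)%N) /\ (forall i j : 'I_n, (i < j)%N -> (k i < k j)%N).

Definition good (R : realType) (X : completeNormedModType R)
    (z : nat -> X) : Prop :=
  [/\ normalized z, basic_sequence z &
      forall (n : nat) (a : 'I_n -> R), exists l : R,
        forall eps : R, 0 < eps -> exists N : nat,
          forall k : 'I_n -> nat, increasing_from N k ->
            `| `|\sum_(i < n) a i *: z (k i)| - l | <= eps].

Definition one_equivalent (R : realType) (E F : completeNormedModType R)
    (u : nat -> E) (v : nat -> F) : Prop :=
  forall a : {fsfun nat -> R with 0}, `|lincomb u a| = `|lincomb v a|.

Definition one_spreading (R : realType) (E : completeNormedModType R)
    (e : nat -> E) : Prop :=
  basic_sequence e /\
  forall f : nat -> nat, {homo f : i j / (i < j)%N} ->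
    one_equivalent e (e \o f).

Definition spreading_model (R : realType) (X E : completeNormedModType R)
    (z : nat -> X) (e : nat -> E) : Prop :=
  [/\ normalized e, schauder_basis_of setT e, one_spreading e &
      forall (eps : R) (n : nat), 0 < eps -> exists N : nat,
        forall (a : 'I_n -> R) (k : 'I_n -> nat),
          (forall i, -1 <= a i <= 1) -> increasing_from N k ->
          `| `|\sum_(i < n) a i *: z (k i)| - `|\sum_(i < n) a i *: e i| |
            <= eps].

(* Main.v *)
Require Import Defs.
From HB Require Import structures.
From mathcomp Require Import all_boot all_order all_algebra finmap.
From mathcomp Require Import all_classical all_reals all_analysis.
From mathcomp Require Import ring lra.

Set Implicit Arguments.
Unset Strict Implicit.
Unset Printing Implicit Defensive.

Import Order.TTheory GRing.Theory Num.Theory.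
Import numFieldNormedType.Exports.

Local Open Scope classical_set_scope.
Local Open Scope ring_scope.

(** Put y_j = sum_(k in E_j) x_k for successive finite sets E_j. The normalized
    constant coefficient blocks of (y_j) are then the vectors
    w(F) = s(F) / |s(F)|, with s(F) = sum_(k in F) x_k, where F runs over the
    finite unions of the E_j. The theorem thus asks for a sequence (E_j) along
    which |a_1 w(F_1) + ... + a_n w(F_n)| converges, for F_1 < ... < F_n finite
    unions of the E_j with min F_1 going to infinity, to a limit depending only
    on a_1, ..., a_n: the limit is then the norm of the common spreading model.

    Such a sequence is given by a form of the Milliken-Taylor theorem for
    countably many bounded functions of block sequences (block_ramsey), applied
    to the norms with rational coefficients. Galvin and Glazer's proof of
    Hindman's theorem gives it directly: let U be an idempotent ultrafilter, for
    the union of finite sets, that contains the sets of all F beyond a given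
    integer (idempotent_tails). The iterated limits along U of a bounded function
    exist, and the E_j are chosen one after the other so that adding to a tuple
    any union of later sets moves these iterated limits by little
    (hindman_diagonal).

    The rest is basis theory. A basic sequence has a finite basis constant: Baire's
    theorem in the closed span, followed by the iteration of the open mapping
    theorem (bounded_expansion). A block sequence of it has the same
    basis constant, and Grunblum's criterion (basis_constant_basic) makes it a
    basic sequence. The limits of the norms form a norm on the finite sequences
    for which the partial sum projections are uniformly bounded; its completion is
    realized as the space of the sequences whose partial sums are Cauchy
    (basis_space), with the unit vectors as a basis. *)

(** * Idempotent ultrafilters *)

Section IdempotentUltrafilter.
Variables (T : Type) (op : T -> T -> T).
Hypothesis opA : associative op.

(** The set of x whose left translate x^-1 A belongs to V; thus the product
    U * V of two ultrafilters is {A | U (star V A)}. *)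
Definition star (V : set_system T) (A : set T) : set T :=
  [set x | V [set y | A (op x y)]].

(** The ultrafilters above an additive filter form a closed subsemigroup of the
    Stone-Cech compactification of T, and every nonempty closed subsemigroup
    arises in this way. *)
Definition additive_filter (F : set_system T) : Prop :=
  forall A V, UltraFilter V -> F `<=` V -> F A -> F (star V A).

(* F corresponds to a nonempty closed subsemigroup of the one given by F0. *)
Let above (F0 F : set_system T) : Prop :=
  [/\ ProperFilter F, additive_filter F & F0 `<=` F].

Lemma ultra_setC (V : set_system T) (A : set T) :
  UltraFilter V -> V (~` A) <-> ~ V A.
Proof.
move=> UV; split => [VC VA|nVA].
  by apply: (@filter_not_empty _ V); rewrite -(setICr A); exact: filterI.
by have [] := in_ultra_setVsetC A UV.
Qed.

Lemma maximal_additive_filter (F0 : set_system T) :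
  ProperFilter F0 -> additive_filter F0 ->
  exists2 F, above F0 F & forall G, above F0 G -> F `<=` G -> G = F.
Proof.
move=> PF0 AF0.
pose P : set (set (set T)) := [set F | F = set0 \/ above F0 F].
have F0ok : above F0 F0 by split.
have [C sCP totC|F [PF maxF]] := @Zorn_bigcup _ P.
  have [[F1 CF1 F1n0]|allC0] := pselect (exists2 F, C F & F <> set0); last first.
    left; rewrite -subset0 => A [F CF FA].
    by apply: allC0; exists F => // F0'; move: FA; rewrite F0'.
  have aboveC F A : C F -> F A -> above F0 F.
    by move=> CF FA; have [F0'|//] := sCP _ CF; move: FA; rewrite F0'.
  right; split.
  - split=> [[F CF]|].
      by move=> F0'; have [PF _ _] := aboveC _ _ CF F0'; exact: (@filter_not_empty _ F).
    have [F10|[PF1 _ _]] := sCP _ CF1; first by [].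
    split.
    + by exists F1 => //; exact: filterT.
    + move=> A B [F CF FA] [G CG GB].
      have [PF _ _] := aboveC _ _ CF FA; have [PG _ _] := aboveC _ _ CG GB.
      by have [sFG|sGF] := totC _ _ CF CG; [exists G|exists F] => //;
        apply: filterI => //; [exact: sFG|exact: sGF].
    + move=> A B sAB [F CF FA]; have [PF _ _] := aboveC _ _ CF FA.
      by exists F => //; exact: filterS FA.
  - move=> A V UV sCV [F CF FA]; have [PF AF _] := aboveC _ _ CF FA.
    exists F => //; apply: AF => //; apply: subset_trans sCV; exact: bigcup_sup.
  - have [//|[_ _ sF01]] := sCP _ CF1.
    by apply: subset_trans sF01 _; exact: bigcup_sup.
have Fok : above F0 F.
  case: PF => [F0'|//]; exfalso; apply: (maxF F0); last by right.
  by rewrite F0'; split => // /(_ setT filterT).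
exists F => // G Gok sFG; apply: contrapT => nGF.
apply: (maxF G); last by right.
by split => // sGF; apply: nGF; apply/seteqP.
Qed.

(** Galvin and Ellis: a compact right-topological semigroup has an idempotent.
    For F maximal, so minimal as a closed subsemigroup, and V above F, both F * V
    and {p above F | p * V = V} are closed subsemigroups, hence equal to F; the
    second equality makes V idempotent. *)
Lemma idempotent_ultrafilter (F0 : set_system T) :
  ProperFilter F0 -> additive_filter F0 ->
  exists U, [/\ UltraFilter U, F0 `<=` U & forall A, U A -> U (star U A)].
Proof.
move=> PF0 AF0; have [F [PF AF sF0] maxF] := maximal_additive_filter PF0 AF0.
have [V [UV sFV]] := ultraFilterLemma PF.
have sFFV : forall A, F A -> F (star V A) by move=> A; exact: AF.
have starI A B : star V (A `&` B) = star V A `&` star V B.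
  apply/seteqP; split => [x VAB|x [VA VB]]; last exact: filterI VA VB.
  by split; apply: filterS VAB => y [].
have starS A B : A `<=` B -> star V A `<=` star V B.
  by move=> sAB x; apply: filterS => y; exact: sAB.
have starC A : star V (~` A) = ~` star V A.
  by apply/seteqP; split => x; rewrite /star/=; apply ultra_setC.
have star_op A x : [set y | star V A (op x y)] = star V [set y | A (op x y)].
  by rewrite /star/=; apply/funext => y /=; congr V; apply/funext => z /=; rewrite opA.
(* The filter {A | F (star V A)} generating the closed subsemigroup F * V. *)
pose G : set_system T := [set A | F (star V A)].
have PG : ProperFilter G.
  split=> [|].
    rewrite /G/= (_ : star V set0 = set0); first exact: filter_not_empty.
    by rewrite -subset0 => x; exact: (@filter_not_empty _ V).
  split=> [|A B GA GB|A B sAB GA].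
  - by rewrite /G/= (_ : star V setT = setT); [exact: filterT|
      rewrite -subTset => x _; exact: filterT].
  - by rewrite /G/= starI; exact: filterI.
  - exact: filterS (starS _ _ sAB) GA.
(* Compactness: every ultrafilter above F * V is of the form p * V. *)
have lift (W : set_system T) : ProperFilter W -> G `<=` W ->
  exists2 H : set_system T, ProperFilter H &
    H = [set A | exists2 B, W B & exists2 C, F C & C `&` star V B `<=` A].
  move=> PW sGW; eexists; last reflexivity; split.
    move=> [B WB [C FC CB0]]; apply: (@filter_not_empty _ W).
    rewrite -(setICr B); apply: filterI => //; apply: sGW.
    by rewrite /G/= starC; apply: filterS FC => x Cx sx; exact: (CB0 x).
  split=> [|A A' [B WB [C FC sA]] [B' WB' [C' FC' sA']]|A A' sAA' [B WB [C FC sA]]].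
  - by exists setT; [exact: filterT|exists setT => //; exact: filterT].
  - exists (B `&` B'); first exact: filterI.
    exists (C `&` C'); first exact: filterI.
    by rewrite starI => x [[Cx C'x] [Bx B'x]]; split; [exact: sA|exact: sA'].
  - by exists B => //; exists C => //; exact: subset_trans sA sAA'.
have GF : G = F.
  apply: maxF => //; split => //; last exact: subset_trans sF0 sFFV.
  move=> A W UW sGW GA.
  have [H PH HE] := lift W _ sGW; have [p [Up sHp]] := ultraFilterLemma PH.
  have sFp : F `<=` p.
    move=> C FC; apply: sHp; rewrite HE; exists setT; first exact: filterT.
    by exists C => // x [].
  have WE B : W B <-> p (star V B).
    split=> [WB|pB].
      apply: sHp; rewrite HE; exists B => //; exists setT; first exact: filterT.
      by move=> x [].
    apply: contrapT => /(ultra_setC B UW) WC.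
    have : p (star V (~` B)).
      apply: sHp; rewrite HE; exists (~` B) => //; exists setT; first exact: filterT.
      by move=> x [].
    by rewrite starC => /(ultra_setC _ Up).
  apply: sFFV; rewrite (_ : star W A = star p (star V A)); first exact: AF.
  by apply/funext => x; apply/propext; rewrite /star/= WE; rewrite -star_op.
have sGV : G `<=` V by rewrite GF.
have [H PH HE] := lift V _ sGV.
have sFH : F `<=` H.
  move=> C FC; rewrite HE; exists setT; first exact: filterT.
  by exists C => // x [].
have HV B : V B -> H (star V B).
  move=> VB; rewrite HE; exists B => //; exists setT; first exact: filterT.
  by move=> x [].
have HF : H = F.
  apply: maxF => //; split => //; last exact: subset_trans sF0 sFH.
  move=> A W UW sHW; rewrite {1}HE => -[B VB [C FC sA]].
  have WVE B' : V B' <-> W (star V B').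
    split=> [VB'|WB']; first exact/sHW/HV.
    apply: contrapT => /(ultra_setC B' UV)/HV/sHW.
    by rewrite starC => /(ultra_setC _ UW).
  have sFW : F `<=` W by exact: subset_trans sHW.
  rewrite HE; exists B => //; exists (star W C); first exact: AF.
  move=> x [WC VBx]; rewrite /star/=.
  apply: (@filterS _ W _ _ _ _ (filterI WC ((WVE _).1 VBx))).
  by move=> y [Cy By]; apply: sA; split => //; rewrite -star_op in By.
exists V; split => //; first exact: subset_trans sF0 sFV.
by move=> A /HV; rewrite HF => /sFV.
Qed.

End IdempotentUltrafilter.

(** * A Ramsey theorem for bounded functions of finite block sequences *)

Section BlockRamsey.
Local Notation fin := {fset nat}.

(** The filter generated by the sets of all nonempty F contained in [m, +oo). *)
Definition tails : set_system fin :=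
  [set A | exists m, forall F : fin,
     F != fset0 -> (forall i, i \in F -> (m <= i)%N) -> A F].

Lemma tails_proper : ProperFilter tails.
Proof.
split=> [[m /(_ [fset m]%fset)]|].
  apply=> [|i]; last by rewrite inE => /eqP ->.
  by apply/fset0Pn; exists m; rewrite inE.
split=> [|A B [m Am] [m' Bm']|A B sAB [m Am]].
- by exists 0%N.
- exists (maxn m m') => F F0 mF; split; [apply: Am|apply: Bm'] => // i /mF;
    by rewrite geq_max => /andP[].
- by exists m => F F0 mF; exact/sAB/Am.
Qed.

Lemma tails_additive : additive_filter (fun A B : fin => A `|` B)%fset tails.
Proof.
move=> A V UV sV [m Am]; exists m => F F0 mF; apply: sV; exists m => G G0 mG.
apply: Am => [|i]; last by rewrite inE => /orP[/mF|/mG].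
by have [i iF] := fset0Pn _ F0; apply/fset0Pn; exists i; rewrite inE iF.
Qed.

Lemma idempotent_tails : exists U, [/\ UltraFilter U, tails `<=` U &
  forall A, U A -> U (star (fun A B : fin => A `|` B)%fset U A)].
Proof.
exact: (idempotent_ultrafilter (@fsetUA _) tails_proper tails_additive).
Qed.

Lemma fset_min (I : fin) : I != fset0 ->
  exists2 j, j \in I & forall i, i \in I -> (j <= i)%N.
Proof.
by move/fset0Pn/ex_minnP => [j jI jmin]; exists j.
Qed.

(** Galvin and Glazer's proof of Hindman's theorem, with a constraint D that may
    depend on the sets chosen so far. *)
Lemma hindman_diagonal (U : set_system fin) (D : seq fin -> set fin) :
  UltraFilter U ->
  (forall A, U A -> U (star (fun A B : fin => A `|` B)%fset U A)) ->
  (forall h, U (D h)) ->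
  exists E : nat -> fin, forall (I : fin) j, j \in I ->
    (forall i, i \in I -> (j <= i)%N) ->
    D (mkseq E j) (\bigcup_(i <- I) E i)%fset.
Proof.
move=> UU idem UD.
have [pick pickP] : {pick : set fin -> fin & forall A, U A ->
    A (pick A) /\ U [set y | A (pick A `|` y)%fset]}.
  apply: (@choice _ _ (fun A x => U A -> A x /\ U [set y | A (x `|` y)%fset])).
  move=> A; have [UA|nUA] := pselect (U A); last by exists fset0.
  by have [x [Ax sAx]] := filter_ex (filterI UA (idem _ UA)); exists x.
(* A state is the list of the sets already chosen, and a member of U in which
   the unions of all later sets will stay. *)
pose next (st : seq fin * set fin) :=
  let A := st.2 `&` D st.1 in
  (rcons st.1 (pick A), A `&` [set y | A (pick A `|` y)%fset]).
pose st n := iter n next ([::], setT).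
pose A n := (st n).2 `&` D (st n).1.
pose E n := pick (A n).
have stE n : (st n).1 = mkseq E n.
  by elim: n => // n IH; rewrite mkseqS -IH.
have Ust n : U (st n).2.
  elim: n => [|n IH]; first exact: filterT.
  have UA : U (A n) by exact: filterI.
  by apply: filterI => //; exact: (pickP _ UA).2.
have UA n : U (A n) by exact: filterI.
have Adecr m n : (m <= n)%N -> A n `<=` A m.
  move=> /subnK <-; elim: (n - m)%N => // k IH; apply: subset_trans IH.
  by move=> y [[]].
have Astep n y : A n.+1 y -> A n (E n `|` y)%fset by move=> [[]].
exists E; suff claim n (I : fin) j : (#|` I| <= n)%N -> j \in I ->
    (forall i, i \in I -> (j <= i)%N) -> A j (\bigcup_(i <- I) E i)%fset.
  by move=> I j jI jmin; rewrite -stE; exact: (claim _ _ _ (leqnn _) jI jmin).2.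
elim: n I j => [I j|n IH I j sI jI jmin].
  by rewrite leqn0 cardfs_eq0 => /eqP -> /[!inE].
rewrite (big_fsetD1 j) //=.
have [I0|In0] := eqVneq (I `\ j)%fset fset0.
  by rewrite I0 big_seq_fset0 fsetU0; exact: (pickP _ (UA j)).1.
have [j' j'I j'min] := fset_min In0.
have jj' : (j < j')%N.
  move: j'I; rewrite !inE => /andP[j'j /jmin]; by rewrite leq_eqVlt eq_sym (negPf j'j).
apply/Astep/(Adecr _ _ jj')/IH => //.
by move: sI; rewrite (cardfsD1 j) jI.
Qed.

Section Limits.
Variables (R : realType) (U : set_system fin).
Hypothesis UU : UltraFilter U.

Lemma ultra_limit (M : R) (h : fin -> R) : (forall F, `|h F| <= M) ->
  exists2 l, `|l| <= M & forall eps : R, 0 < eps -> U [set F | `|h F - l| <= eps].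
Proof.
move=> hM.
have UM : U (h @^-1` [set` `[- M, M]]).
  by apply: filterS (@filterT _ U _) => F _ /=; rewrite in_itv/= -ler_norml.
have [l [lM cl]] := @segment_compact R (- M) M (h @ U) _ UM.
exists l; first by move: lM; rewrite /= in_itv/= -ler_norml.
move=> eps eps0.
have [//|UC] := in_ultra_setVsetC [set F | `|h F - l| <= eps] UU.
have [|x [/= xC xB]] := cl [set x | ~ (`|x - l| <= eps)] (ball l eps) _ (nbhsx_ballx _ _ eps0).
  exact: UC.
by exfalso; apply: xC; rewrite distrC ltW.
Qed.

(** For size s <= n, L s is the iterated limit of g along U in the missing n - size s variables. *)
Lemma iterated_limit (n : nat) (M : R) (g : seq fin -> R) :
  (forall s, `|g s| <= M) ->
  exists L : seq fin -> R, (forall s, size s = n -> L s = g s) /\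
    forall s (eps : R), (size s < n)%N -> 0 < eps ->
      U [set F | `|L (rcons s F) - L s| <= eps].
Proof.
move=> gM.
have [lim limP] : {lim : (fin -> R) -> R & forall h, (forall F, `|h F| <= M) ->
    `|lim h| <= M /\ forall eps : R, 0 < eps -> U [set F | `|h F - lim h| <= eps]}.
  apply: (@choice _ _ (fun h l => (forall F, `|h F| <= M) ->
    `|l| <= M /\ forall eps : R, 0 < eps -> U [set F | `|h F - l| <= eps])).
  move=> h; have [hM|] := pselect (forall F, `|h F| <= M); last by exists 0.
  by have [l] := ultra_limit hM; exists l.
pose Lr := fix Lr (r : nat) (s : seq fin) {struct r} : R :=
  if r is r'.+1 then lim (fun F => Lr r' (rcons s F)) else g s.
have LrM r s : `|Lr r s| <= M.
  by elim: r s => [|r IH] s //=; apply: (limP _ _).1.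
exists (fun s => Lr (n - size s)%N s); split=> [s ->|s eps sn eps0].
  by rewrite subnn.
rewrite (_ : (n - size s)%N = (n - (size s).+1).+1); last by rewrite subnSK.
rewrite /=; have := (limP (fun F => Lr (n - (size s).+1)%N (rcons s F)) _).2 eps eps0.
by under [X in _ -> U X]eq_set do rewrite size_rcons; apply=> F; exact: LrM.
Qed.

Lemma filter_all_seq (I : choiceType) (s : seq I) (P : I -> set fin) :
  (forall x, x \in s -> U (P x)) -> U [set y | forall x, x \in s -> P x y].
Proof.
elim: s => [|a s IH] Ps; first by apply: filterS filterT.
have Us : U [set y | forall x, x \in s -> P x y].
  by apply: IH => x xs; apply: Ps; rewrite inE xs orbT.
apply: filterS (filterI (Ps a (mem_head _ _)) Us) => y [Pa Py] x.
by rewrite inE => /predU1P[->|/Py].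
Qed.

End Limits.

(** The words of length at most n over the alphabet A. *)
Fixpoint words (T : eqType) (A : seq T) (n : nat) : seq (seq T) :=
  if n is m.+1 then [::] :: [seq x :: s | x <- A, s <- words A m] else [:: [::]].

Lemma mem_words (T : eqType) (A : seq T) n s :
  (size s <= n)%N -> {subset s <= A} -> s \in words A n.
Proof.
elim: n s => [|n IH] [|a s] //= sn sA; rewrite inE /=.
apply: allpairs_f; first by apply: sA; exact: mem_head.
by apply: IH => // x xs; apply: sA; rewrite inE xs orbT.
Qed.

(** The first n sets t 0, t 1, ... are nonempty, successive, and contained in
    [N, +oo). *)
Definition successive (n N : nat) (t : nat -> fin) : Prop :=
  [/\ forall a, (a < n)%N -> t a != fset0,
      forall a k, (a < n)%N -> k \in t a -> (N <= k)%N &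
      forall a b, (a < b < n)%N -> fset_before (t a) (t b)].

(** A Milliken-Taylor theorem for countably many bounded functions g i of ar i
    successive finite sets: along the finite unions of the E k, each of them
    converges. *)
Lemma block_ramsey (R : realType) (ar : nat -> nat) (g : nat -> seq fin -> R)
    (M : nat -> R) : (forall i s, `|g i s| <= M i) ->
  exists E : nat -> fin,
    [/\ forall j, E j != fset0, forall j, fset_before (E j) (E j.+1) &
      forall i, exists l, forall eps : R, 0 < eps -> exists N, forall t : nat -> fin,
        successive (ar i) N t ->
        `|g i (mkseq (fun a => \bigcup_(k <- t a) E k)%fset (ar i)) - l| <= eps].
Proof.
move=> gM; have [U [UU sU idem]] := idempotent_tails.
have [L LP] := choice (fun i => iterated_limit UU (ar i) (gM i)).
pose D (h : seq fin) : set fin :=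
  [set F | F != fset0] `&` ([set F | forall x, x \in h -> fset_before x F] `&`
  [set F | forall i, i \in iota 0 (size h) ->
     forall s, s \in words (fpowerset (\bigcup_(x <- h) x)%fset) (size h) ->
       (size s < ar i)%N -> `|L i (rcons s F) - L i s| <= (size h).+1%:R^-1]).
have UD h : U (D h).
  apply: filterI; first by apply: sU; exists 0%N => F.
  apply: filterI.
    apply: filter_all_seq => x _; apply: sU.
    exists (\max_(k <- x) k).+1%N => F _ mF i j ix /mF; apply: leq_trans.
    by rewrite ltnS; exact: leq_bigmax_seq.
  apply: filter_all_seq => i _; apply: filter_all_seq => s _.
  have [sn|sn] := ltnP (size s) (ar i); last by apply: filterS filterT.
  by apply: filterS ((LP i).2 s (size h).+1%:R^-1 sn _) => [F //|]; rewrite invr_gt0.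
have [E EP] := hindman_diagonal UU idem UD.
have E1 j : D (mkseq E j) (E j).
  have /(_ (fset11 j)) := EP [fset j]%fset j.
  by rewrite big_seq_fset1; apply => i; rewrite inE => /eqP ->.
exists E; split=> [j|j|i]; first by have [] := E1 j.
  have [_ [+ _]] := E1 j.+1; apply; apply/mapP; exists j => //.
  by rewrite mem_iota ltnS leqnn.
exists (L i [::]) => eps eps0.
(* N bounds i and n, so that the constraint is active from the N-th set on, and
   n / eps, so that n errors of size 1 / N.+1 add up to at most eps. *)
pose n := ar i; exists (i.+1 + n + (Num.truncn (n%:R / eps)).+1)%N.
set N := (_ + _)%N => t [t0 tN tblock]; pose F a := (\bigcup_(k <- t a) E k)%fset.
rewrite -(LP i).1 ?size_mkseq //.
suff dist a : (a <= n)%N -> `|L i (mkseq F a) - L i [::]| <= a%:R * N.+1%:R^-1.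
  apply: le_trans (dist n (leqnn _)) _.
  rewrite ler_pdivrMr // -ler_pdivrMl // mulrC.
  apply: le_trans (ltW (truncnS_gt _)) _.
  by rewrite ler_nat /N leqW // leq_addl.
elim: a => [|a IH] an; first by rewrite subrr normr0 mul0r.
rewrite mkseqS -(subrKA (L i (mkseq F a))) -natr1 mulrDl mul1r [leRHS]addrC.
apply: le_trans (ler_normD _ _) _; rewrite lerD ?IH 1?ltnW //.
(* The union over t a is a union of sets chosen at step j = min (t a) or later,
   while the preceding unions involve only sets chosen before step j. *)
have [j jt jmin] := fset_min (t0 a an).
have Nj : (N <= j)%N by exact: tN an jt.
have [_ [_ +]] := EP (t a) j jt jmin; rewrite size_mkseq => /(_ i).
rewrite mem_iota /= add0n => /(_ _ (mkseq F a)) /[!size_mkseq] lej.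
apply: le_trans (lej _ _ an) _.
- by apply: leq_trans Nj; rewrite /N -addnA leq_addr.
- apply: mem_words.
    by rewrite size_mkseq (leq_trans (ltnW an)) // (leq_trans _ Nj) // /N addnAC leq_addl.
  move=> x /mapP[b]; rewrite mem_iota add0n => /= ba ->.
  rewrite fpowersetE; apply/bigfcupsP => k kt _; apply/fsubsetP => e ek.
  apply/bigfcupP; exists (E k) => //; rewrite andbT; apply/mapP; exists k => //.
  by rewrite mem_iota add0n /=; apply: (tblock b a) jt; rewrite ?ba.
- by rewrite lef_pV2 ?posrE // ler_nat ltnS.
Qed.

End BlockRamsey.

(** * Basis constants *)

Section PartialSums.
Variables (R : realType) (X : completeNormedModType R).
Implicit Types (u : nat -> X) (a b : nat -> R).

(** The n-th partial sum of the series of the a i *: u i. *)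
Definition psum u a (n : nat) : X := \sum_(0 <= i < n) a i *: u i.

(** The coordinates of index at least n are set to 0. *)
Definition cutoff (n : nat) a : nat -> R := fun i => if (i < n)%N then a i else 0.

Lemma psumS u a n : psum u a n.+1 = psum u a n + a n *: u n.
Proof. by rewrite /psum big_nat_recr. Qed.

Lemma psumB u a b n : psum u (fun i => a i - b i) n = psum u a n - psum u b n.
Proof. by rewrite /psum -sumrB; apply: eq_bigr => i _; rewrite scalerBl. Qed.

Lemma psumD u a b n : psum u (fun i => a i + b i) n = psum u a n + psum u b n.
Proof. by rewrite /psum -big_split; apply: eq_bigr => i _; rewrite scalerDl. Qed.

Lemma psumZ u c a n : psum u (fun i => c * a i) n = c *: psum u a n.
Proof. by rewrite /psum scaler_sumr; apply: eq_bigr => i _; rewrite scalerA. Qed.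

Lemma psum0 u n : psum u (fun=> 0) n = 0.
Proof. by rewrite /psum big1 // => i _; rewrite scale0r. Qed.

Lemma eq_psum u a b n : (forall i, (i < n)%N -> a i = b i) -> psum u a n = psum u b n.
Proof. by move=> ab; apply: eq_big_nat => i /andP[_ /ab ->]. Qed.

Lemma eq_psum_vect u v a n : (forall i, (i < n)%N -> u i = v i) -> psum u a n = psum v a n.
Proof. by move=> uv; apply: eq_big_nat => i /andP[_ /uv ->]. Qed.

Lemma psum_delta u i : psum u (fun j => (j == i)%:R) i.+1 = u i.
Proof.
rewrite psumS eqxx scale1r (eq_psum _ (b := fun=> 0)) ?psum0 ?add0r // => j ji.
by rewrite ltn_eqF.
Qed.

Lemma psum_dist u a b n : (forall i, (i < n)%N -> `|u i| <= 1) ->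
  `|psum u a n - psum u b n| <= \sum_(0 <= i < n) `|a i - b i|.
Proof.
move=> u1; rewrite -psumB; apply: le_trans (ler_norm_sum _ _ _) _.
rewrite !big_nat; apply: ler_sum => i /andP[_ /u1 ui].
by rewrite normrZ -[leRHS]mulr1 ler_wpM2l.
Qed.

Lemma psum_cutoff u a m n : psum u (cutoff m a) n = psum u a (minn n m).
Proof.
elim: n => [|n IH]; first by rewrite min0n /psum !big_nil.
rewrite psumS IH /cutoff; case: ltnP => [nm|mn].
  by rewrite (minn_idPl nm) psumS.
by rewrite scale0r addr0 (minn_idPr (leqW mn)).
Qed.

Lemma cvg_psum_cutoff u a m : psum u (cutoff m a) @ \oo --> psum u a m.
Proof.
apply: cvg_near_cst; exists m => // n /= mn.
by rewrite psum_cutoff (minn_idPr mn).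
Qed.

Lemma cvg_psum0 u : psum u (fun=> 0) @ \oo --> (0 : X).
Proof. by apply: cvg_near_cst; apply: nearW => n; rewrite psum0. Qed.

Lemma psum_coef u a n : normalized u -> `|psum u a n.+1 - psum u a n| = `|a n|.
Proof. by move=> nu; rewrite psumS addrC addKr normrZ nu mulr1. Qed.

Lemma lincomb_psum u (a : {fsfun nat -> R with 0}) n :
  (forall k, k \in finsupp a -> (k < n)%N) -> lincomb u a = psum u a n.
Proof.
move=> an; rewrite /psum big_mkord.
rewrite -(big_mkord xpredT (fun i => a i *: u i)) /lincomb.
apply/esym; rewrite (bigID (mem (finsupp a))) /= addrC big1 ?add0r; last first.
  by move=> i /fsfun_dflt ->; rewrite scale0r.
rewrite -big_filter; apply: perm_big; apply: uniq_perm; rewrite ?fset_uniq //.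
  by rewrite filter_uniq // iota_uniq.
move=> k; rewrite mem_filter mem_index_iota /=.
by case: (boolP (k \in finsupp a)) => //= /an.
Qed.

Lemma psum_lincomb u a n : exists2 c : {fsfun nat -> R with 0},
  psum u a n = lincomb u c & forall i, (i < n)%N -> c i = a i.
Proof.
pose c : {fsfun nat -> R with 0} := [fsfun i in [fset i in iota 0 n]%fset => a i | 0].
have cE i : (i < n)%N -> c i = a i.
  by move=> i_n; rewrite fsfunE !inE mem_iota add0n /= i_n.
exists c => //; rewrite (@lincomb_psum _ _ n).
  by apply: eq_psum => i /cE.
by move=> k; rewrite mem_finsupp fsfunE !inE mem_iota add0n /=; case: (k < n)%N; rewrite ?eqxx.
Qed.

Lemma lin_spanE u v : lin_span u v <-> exists a n, v = psum u a n.
Proof.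
split=> [[a _ <-]|[a [n ->]]]; last first.
  by have [c -> _] := psum_lincomb u a n; exists c.
exists a, (\max_(k <- finsupp a) k).+1; apply: lincomb_psum => k ka.
by rewrite ltnS; exact: leq_bigmax_seq.
Qed.

Lemma closure_distP (A : set X) v :
  closure A v <-> forall eps : R, 0 < eps -> exists2 w, A w & `|v - w| < eps.
Proof.
split=> [Av eps eps0|Av B].
  have [w [Aw /=]] := Av _ (nbhsx_ballx v eps eps0).
  by rewrite -ball_normE; exists w.
rewrite -nbhs_ballE => -[eps /= eps0 sB].
by have [w Aw vw] := Av _ eps0; exists w; split => //; apply: sB; rewrite -ball_normE.
Qed.

Lemma cvg_psum_closure u a v : psum u a @ \oo --> v -> closure (lin_span u) v.
Proof.
move=> av; apply/closure_distP => eps eps0.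
have [N _ /(_ N (leqnn N))/= vN] := ((cvgrPdist_lt _ _).1 av) eps eps0.
by exists (psum u a N) => //; apply/lin_spanE; exists a, N.
Qed.

Lemma closure_spanB u v w : closure (lin_span u) v -> closure (lin_span u) w ->
  closure (lin_span u) (v - w).
Proof.
move=> /closure_distP Vv /closure_distP Vw; apply/closure_distP => eps eps0.
have [v' /lin_spanE[a [n ->]] vv'] := Vv (eps / 2) (divr_gt0 eps0 (ltr0Sn _ 1)).
have [w' /lin_spanE[b [m ->]] ww'] := Vw (eps / 2) (divr_gt0 eps0 (ltr0Sn _ 1)).
exists (psum u a n - psum u b m).
  apply/lin_spanE; exists (fun i => cutoff n a i - cutoff m b i), (maxn n m).
  by rewrite psumB !psum_cutoff (minn_idPr (leq_maxl _ _)) (minn_idPr (leq_maxr _ _)).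
rewrite opprD addrACA -opprD (le_lt_trans (ler_normB _ _)) //.
by rewrite [ltRHS](splitr eps) ltrD.
Qed.

Lemma closure_spanZ u c v : closure (lin_span u) v -> closure (lin_span u) (c *: v).
Proof.
move=> /closure_distP Vv; apply/closure_distP => eps eps0.
have c0 : 0 < `|c| + 1 by rewrite ltr_wpDl.
have [v' /lin_spanE[a [n ->]] vv'] := Vv (eps / (`|c| + 1)) (divr_gt0 eps0 c0).
exists (c *: psum u a n); first by apply/lin_spanE; exists (fun i => c * a i), n; rewrite psumZ.
rewrite -scalerBr normrZ; rewrite ltr_pdivlMr // mulrC in vv'.
by apply: le_lt_trans vv'; rewrite ler_wpM2r // lerDl.
Qed.

Lemma cauchy_seq_cvg (V : completeNormedModType R) (v : nat -> V) (d : nat -> R) :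
  d @ \oo --> 0 -> (forall i j, (i <= j)%N -> `|v j - v i| <= d i) -> cvg (v @ \oo).
Proof.
move=> d0 vd; apply/cauchy_cvgP/cauchy_exP => eps eps0.
have [N _ /(_ N (leqnn N))/= dN] := ((cvgr0Pnorm_lt _).1 d0) eps eps0.
exists (v N), N => // n /= Nn; rewrite -ball_normE /= distrC.
by apply: le_lt_trans (vd _ _ Nn) _; apply: le_lt_trans dN; exact: ler_norm.
Qed.

(** Vectors w_ J converging to w, with expansions b J that are uniformly Cauchy
    in the sup norm of the partial sums: w has an expansion. *)
Lemma cvg_expansions u (b : nat -> nat -> R) (d : nat -> R) (w_ : nat -> X) (w : X) :
  normalized u -> d @ \oo --> 0 ->
  (forall J L n, (J <= L)%N -> `|psum u (b L) n - psum u (b J) n| <= d J) ->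
  (forall J, psum u (b J) @ \oo --> w_ J) -> w_ @ \oo --> w ->
  exists a, psum u a @ \oo --> w /\
    forall J n, `|psum u a n - psum u (b J) n| <= d J.
Proof.
move=> nu d0 bd bw ww.
have coord i : cvg ((fun J => b J i) @ \oo).
  apply: (@cauchy_seq_cvg R^o _ (fun J => d J + d J)).
    by rewrite -[0]addr0; exact: cvgD.
  move=> J L JL; rewrite -(psum_coef (fun i => b L i - b J i) i nu) !psumB.
  by apply: le_trans (ler_normB _ _) _; exact: lerD (bd _ _ _ JL) (bd _ _ _ JL).
pose a i : R := lim ((fun J => b J i) @ \oo).
have cvgS n : (fun L => psum u (b L) n) @ \oo --> psum u a n.
  elim: n => [|n IH].
    by under eq_fun do rewrite /psum big_nil; rewrite /psum big_nil; exact: cvg_cst.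
  under eq_fun do rewrite psumS; rewrite psumS; apply: cvgD => //.
  by apply: cvgZr_tmp; exact: coord.
have ad J n : `|psum u a n - psum u (b J) n| <= d J.
  have cvgN : (fun L => `|psum u (b L) n - psum u (b J) n|) @ \oo -->
      `|psum u a n - psum u (b J) n|.
    by apply: cvg_norm; apply: cvgB => //; exact: cvg_cst.
  rewrite -(cvg_lim _ cvgN) //; apply: limr_le; first exact: cvgP cvgN.
  by exists J => // L /= JL; exact: bd.
exists a; split=> //.
apply/cvgrPdist_le => eps eps0.
have e3 : 0 < eps / 3 by rewrite divr_gt0.
have [N1 _ dN] := ((cvgr0Pnorm_le _).1 d0) _ e3.
have [N2 _ wN] := ((cvgrPdist_le _ _).1 ww) _ e3.
pose J := maxn N1 N2.
have [N _ bN] := ((cvgrPdist_le _ _).1 (bw J)) _ e3.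
exists N => // n /= /bN/= h3; have /= h2 := wN J (leq_maxr _ _).
have h1 := le_trans (ad J n) (le_trans (ler_norm _) (dN J (leq_maxl _ _))).
rewrite (_ : w - _ = (w - w_ J) + (w_ J - psum u (b J) n) -
  (psum u a n - psum u (b J) n)); last by rewrite opprB !subrKA.
apply: le_trans (ler_normB _ _) _.
have := ler_normD (w - w_ J) (w_ J - psum u (b J) n); lra.
Qed.

End PartialSums.

Section BasisConstant.
Variables (R : realType) (X : completeNormedModType R).
Implicit Types (u : nat -> X) (a b : nat -> R).

(** K is positive and bounds the norms of the canonical partial sum projections of u. *)
Definition basis_constant u (K : R) : Prop := 0 < K /\
  forall a n m, (n <= m)%N -> `|psum u a n| <= K * `|psum u a m|.

Lemma cvg_half_pow (c : R) : (fun n => c * 2^-1 ^+ n) @ \oo --> 0.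
Proof.
apply: (@cvg_geometric _ c 2^-1); rewrite ger0_norm ?invr_ge0 //.
by rewrite invf_lt1 // ltr1n.
Qed.

(** Baire's theorem inside a closed set V: a countable cover of V has a member
    that is dense in some ball of V. *)
Lemma closed_baire (V : set X) (A : nat -> set X) : closed V -> V !=set0 ->
  V `<=` \bigcup_m A m ->
  exists m v0 (r : R), [/\ 0 < r, V v0 &
    forall w, V w -> `|w - v0| < r ->
      forall del : R, 0 < del -> exists2 a, A m a & `|w - a| < del].
Proof.
move=> clV [v Vv] VA; apply: contrapT => noA.
(* Shrinking balls of V, the (m+1)-st at a positive distance from A m. *)
have step (p : nat * (X * R)) : exists q : X * R, V p.2.1 -> 0 < p.2.2 ->
    [/\ V q.1, 0 < q.2, q.2 <= p.2.2 / 2, `|q.1 - p.2.1| + q.2 < p.2.2 &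
      forall x, A p.1 x -> q.2 < `|q.1 - x|].
  case: p => m [v0 r] /=; have [Vv0|] := pselect (V v0); last by exists (v0, r).
  have [r0|] := pselect (0 < r); last by exists (v0, r).
  have : exists w, [/\ V w, `|w - v0| < r & exists2 del : R, 0 < del &
      forall x, A m x -> del <= `|w - x|].
    apply: contrapT => now; apply: noA; exists m, v0, r; split => // w Vw wr del del0.
    apply: contrapT => nodel; apply: now; exists w; split => //.
    exists del => // x Ax; rewrite leNgt; apply/negP => wx; apply: nodel.
    by exists x.
  move=> [w [Vw wr [del del0 delP]]].
  have t0 : 0 < Num.min del (r - `|w - v0|) by rewrite lt_min del0 subr_gt0.
  exists (w, Num.min del (r - `|w - v0|) / 2) => _ _ /=.
  have td : Num.min del (r - `|w - v0|) <= del by rewrite ge_min lexx.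
  have tr : Num.min del (r - `|w - v0|) <= r - `|w - v0| by rewrite ge_min lexx orbT.
  have := normr_ge0 (w - v0).
  set t := Num.min _ _ in t0 td tr *; move=> n0.
  by split => //; [lra|lra|lra|move=> x /delP; lra].
have [f fP] := choice step.
pose s n : X * R := nat_rect (fun=> (X * R)%type) (v, 1) (fun n p => f (n, p)) n.
have sV n : V (s n).1 /\ 0 < (s n).2.
  elim: n => [|n [Vn rn]] //=.
  by have [] := fP (n, s n) Vn rn.
have sP n : [/\ (s n.+1).2 <= (s n).2 / 2,
    `|(s n.+1).1 - (s n).1| + (s n.+1).2 < (s n).2 &
    forall x, A n x -> (s n.+1).2 < `|(s n.+1).1 - x|].
  by have [Vn rn] := sV n; have [] := fP (n, s n) Vn rn.
have nested n k : `|(s (k + n)%N).1 - (s n).1| <= (s n).2 - (s (k + n)%N).2.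
  elim: k => [|k IH]; first by rewrite add0n !subrr normr0.
  have [_ h _] := sP (k + n)%N.
  have := ler_distD (s (k + n)%N).1 (s (k.+1 + n)%N).1 (s n).1.
  rewrite addSn in h *; lra.
have nested' i j : (i <= j)%N -> `|(s j).1 - (s i).1| <= (s i).2.
  move=> ij; have := nested i (j - i)%N; rewrite subnK //.
  by have := (sV j).2; lra.
have r0 : (fun n => (s n).2) @ \oo --> (0 : R).
  have rle n : 0 <= (s n).2 <= 1 * 2^-1 ^+ n.
    rewrite (ltW (sV n).2) /= mul1r; elim: n => [|n IH] //=.
    have [+ _ _] := sP n; rewrite exprSr /=; lra.
  apply: (squeeze_cvgr _ (cvg_cst 0) (cvg_half_pow 1)).
  by exists 0%N => // n _; exact: rle.
have /cvg_ex[/= l sl] := cauchy_seq_cvg r0 nested'.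
have Vl : V l.
  apply: (@closed_cvg _ _ \oo eventually_filter (fun n => (s n).1)) => //.
  by exists 0%N => // n _; exact: (sV n).1.
have [m _ Aml] := VA _ Vl.
have [_ _ /(_ _ Aml)] := sP m.
apply/negP; rewrite -leNgt distrC.
have cvgN : (fun n => `|(s n).1 - (s m.+1).1|) @ \oo --> `|l - (s m.+1).1|.
  by apply: cvg_norm; apply: cvgB => //; exact: cvg_cst.
rewrite -(cvg_lim _ cvgN) //; apply: limr_le; first exact: cvgP cvgN.
by exists m.+1 => // n mn; exact: (nested' m.+1 n mn).
Qed.

Section Basic.
Variable u : nat -> X.
Hypotheses (nu : normalized u) (bu : basic_sequence u).

Local Notation V := (closure (lin_span u)).

Lemma basic_expansion (v : X) : V v -> exists a, psum u a @ \oo --> v.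
Proof. by move=> /bu.2[a [av _]]; exists a. Qed.

Lemma basic_unique a b (v : X) : psum u a @ \oo --> v -> psum u b @ \oo --> v -> a = b.
Proof.
move=> av bv; have [c [_ cu]] := bu.2 v (cvg_psum_closure av).
by rewrite -(cu a) // -(cu b).
Qed.

(** Baire's theorem gives density of the vectors with bounded partial sums in a
    ball; by symmetry and convexity the ball can be centred at 0. *)
Lemma bounded_approximation : exists2 C : R, 0 < C & forall w (eps : R),
  V w -> 0 < eps -> exists a w', [/\ psum u a @ \oo --> w',
    forall n, `|psum u a n| <= C * `|w| & `|w - w'| <= eps].
Proof.
pose A m : set X := [set v | exists2 a, psum u a @ \oo --> v &
  forall n, `|psum u a n| <= m%:R].
have VA : V `<=` \bigcup_m A m.
  move=> v /basic_expansion[a av].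
  have /cvg_seq_bounded/pinfty_ex_gt0[M M0 MP] : cvg (psum u a @ \oo) by exact: cvgP av.
  exists (Num.truncn M).+1 => //; exists a => // n.
  by apply: le_trans (MP n I) _; exact: ltW (truncnS_gt _).
have V0 : V !=set0.
  by exists 0; apply: (@cvg_psum_closure _ _ _ (fun=> 0)); exact: cvg_psum0.
have [m [v0 [r [r0 Vv0 dense]]]] := closed_baire (@closed_closure _ _) V0 VA.
exists ((2 * m%:R + 1) / r); first by rewrite divr_gt0 // ltr_wpDl // mulr_ge0.
move=> w eps Vw eps0; have [->|w0] := eqVneq w 0.
  exists (fun=> 0), 0; split.
  - exact: cvg_psum0.
  - by move=> n; rewrite psum0 !normr0 mulr0.
  - by rewrite subrr normr0 ltW.
have nw0 : 0 < `|w| by rewrite normr_gt0.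
pose t := r / (2 * `|w|); have t0 : 0 < t by rewrite divr_gt0 ?mulr_gt0.
have tw : `|t *: w| < r.
  rewrite normrZ gtr0_norm // (_ : t * _ = r / 2); first by lra.
  by rewrite /t; field; rewrite gt_eqF.
have Vtw : V (t *: w) by exact: closure_spanZ.
have Vm : V (v0 - t *: w) by exact: closure_spanB.
have Vp : V (v0 + t *: w).
  by rewrite -[t *: w]opprK -scaleNr; apply: closure_spanB => //; exact: closure_spanZ.
have e1 : 0 < eps * t by exact: mulr_gt0.
have [|w1 [a1 aw1 a1m] ww1] := dense _ Vp _ _ e1; first by rewrite addrC addKr.
have [|w2 [a2 aw2 a2m] ww2] := dense _ Vm _ _ e1; first by rewrite addrC addKr normrN.
exists (fun i => (2 * t)^-1 * (a1 i - a2 i)), ((2 * t)^-1 *: (w1 - w2)).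
have t20 : 0 < 2 * t by rewrite mulr_gt0.
have SE n : psum u (fun i => (2 * t)^-1 * (a1 i - a2 i)) n =
    (2 * t)^-1 *: (psum u a1 n - psum u a2 n).
  by rewrite (psumZ u _ (fun i => a1 i - a2 i)) psumB.
split.
- by rewrite (funext SE); apply: cvgZl_tmp; exact: cvgB.
- move=> n; rewrite SE normrZ gtr0_norm ?invr_gt0 // ler_pdivrMl //.
  rewrite /t; apply: le_trans (ler_normB _ _) _.
  apply: le_trans (lerD (a1m n) (a2m n)) _.
  rewrite (_ : 2 * _ * _ = 2 * m%:R + 1); last by field; rewrite !gt_eqF.
  lra.
- rewrite (_ : w - _ = (2 * t)^-1 *: ((v0 + t *: w - w1) - (v0 - t *: w - w2))); last first.
    have -> : v0 + t *: w - w1 - (v0 - t *: w - w2) = (2 * t) *: w - (w1 - w2).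
      rewrite mulr_natl mulr2n scalerDl !opprD !opprK.
      by rewrite (AC (3*3) (1*4*(2*5)*(3*6)))/= subrr add0r.
    by rewrite [RHS]scalerBr scalerA mulVf ?scale1r // gt_eqF.
  rewrite normrZ gtr0_norm ?invr_gt0 // ler_pdivrMl //.
  apply: le_trans (ler_normB _ _) _.
  lra.
Qed.

(** The iteration of the open mapping theorem: the approximations of the
    successive remainders sum up to an expansion with bounded partial sums. *)
Lemma bounded_expansion : exists2 C : R, 0 < C & forall w, V w ->
  exists2 a, psum u a @ \oo --> w & forall n, `|psum u a n| <= C * `|w|.
Proof.
have [C C0 approx] := bounded_approximation.
exists (2 * C) => [|w Vw]; first by rewrite mulr_gt0.
have [->|w0] := eqVneq w 0.
  by exists (fun=> 0) => [|n]; rewrite ?psum0 ?normr0 ?mulr0 //; exact: cvg_psum0.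
have nw0 : 0 < `|w| by rewrite normr_gt0.
pose e j : R := `|w| * 2^-1 ^+ j.
have e0 j : 0 < e j by rewrite mulr_gt0 // exprn_gt0 // invr_gt0.
have eS j : e j.+1 = e j / 2 by rewrite /e exprSr mulrA.
have [F FP] : {F : X * nat -> (nat -> R) * X & forall p, V p.1 ->
    [/\ psum u (F p).1 @ \oo --> (F p).2,
      forall n, `|psum u (F p).1 n| <= C * `|p.1| &
      `|p.1 - (F p).2| <= e p.2.+1]}.
  apply: (@choice _ _ (fun p q => V p.1 -> [/\ psum u q.1 @ \oo --> q.2,
      forall n, `|psum u q.1 n| <= C * `|p.1| & `|p.1 - q.2| <= e p.2.+1])).
  move=> [v j]; have [/= Vv|] := pselect (V v); last by exists (fun=> 0, 0).
  by have [a [w' ?]] := approx v (e j.+1) Vv (e0 _); exists (a, w').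
pose s j : (nat -> R) * X := nat_rect (fun=> ((nat -> R) * X)%type) (fun=> 0, w)
  (fun j p => (fun i => p.1 i + (F (p.2, j)).1 i, p.2 - (F (p.2, j)).2)) j.
have sV j : V (s j).2 /\ `|(s j).2| <= e j.
  elim: j => [|j [Vj _]]; first by rewrite /e expr0 mulr1.
  have [cj _ ej] := FP ((s j).2, j) Vj; split=> //=.
  by apply: closure_spanB => //; exact: cvg_psum_closure cj.
have sc j : psum u (s j).1 @ \oo --> w - (s j).2.
  elim: j => [|j IH]; first by rewrite subrr; exact: cvg_psum0.
  have [cj _ _] := FP ((s j).2, j) (sV j).1.
  rewrite [psum _ _](funext (psumD u (s j).1 (F ((s j).2, j)).1)) /=.
  by rewrite opprB addrA addrAC; exact: cvgD.
have sb j n : `|psum u (s j.+1).1 n - psum u (s j).1 n| <= C * e j.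
  have [_ bj _] := FP ((s j).2, j) (sV j).1.
  rewrite /= psumD addrC addKr; apply: le_trans (bj n) _.
  by rewrite ler_pM2l //; exact: (sV j).2.
have sJL J k n : `|psum u (s (k + J)%N).1 n - psum u (s J).1 n| <=
    2 * C * (e J - e (k + J)%N).
  elim: k => [|k IH]; first by rewrite !subrr normr0 mulr0.
  have := ler_distD (psum u (s (k + J)%N).1 n) (psum u (s (k.+1 + J)%N).1 n)
    (psum u (s J).1 n).
  have := sb (k + J)%N n; rewrite addSn eS; lra.
have [||||a [aw ab]] := @cvg_expansions _ _ u (fun j => (s j).1)
    (fun j => 2 * C * `|w| * 2^-1 ^+ j) (fun j => w - (s j).2) w nu.
- exact: cvg_half_pow.
- move=> J L n JL; have := sJL J (L - J)%N n; rewrite subnK // => h.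
  apply: le_trans h _; rewrite -(mulrA (2 * C) `|w|) ler_pM2l ?mulr_gt0 //.
  by rewrite lerBlDr lerDl ltW.
- exact: sc.
- rewrite -[X in _ --> X]subr0; apply: cvgB; first exact: cvg_cst.
  apply/cvgr0Pnorm_le => eps eps0.
  have [N _ NP] := (cvgr0Pnorm_le _).1 (cvg_half_pow `|w|) eps eps0.
  exists N => // n /NP /=; apply: le_trans; apply: le_trans (sV n).2 _.
  exact: ler_norm.
exists a => // n; have := ab 0%N n.
by rewrite /= psum0 subr0 expr0 mulr1.
Qed.

Lemma basic_basis_constant : exists K, basis_constant u K.
Proof.
have [C C0 CP] := bounded_expansion; exists C; split => // a n m nm.
have [|b bc bb] := CP (psum u a m).
  by apply: subset_closure; apply/lin_spanE; exists a, m.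
have -> : psum u a n = psum u b n; last exact: bb.
rewrite (basic_unique bc (@cvg_psum_cutoff _ _ u a m)) psum_cutoff.
by rewrite (minn_idPl nm).
Qed.

End Basic.

Lemma basis_constant_coef u K a i m : normalized u -> basis_constant u K ->
  (i < m)%N -> `|a i| <= 2 * K * `|psum u a m|.
Proof.
move=> nu [K0 uK] im; rewrite -(psum_coef a i nu).
apply: le_trans (ler_normB _ _) _.
have := uK a i m (ltnW im); have := uK a i.+1 m im; lra.
Qed.

(** Grunblum's criterion. *)
Lemma basis_constant_basic u K : normalized u -> basis_constant u K -> basic_sequence u.
Proof.
move=> nu uK; have K0 := uK.1; split=> [i|v Vv].
  apply: subset_closure; apply/lin_spanE; exists (fun j => (j == i)%:R), i.+1.
  by rewrite psum_delta.
suff [a av] : exists a, psum u a @ \oo --> v.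
  exists a; split => // b bv; apply/funext => i; apply/eqP.
  rewrite -subr_eq0 -normr_le0.
  have cvg0 : (fun m => 2 * K * `|psum u a m - psum u b m|) @ \oo --> (0 : R).
    rewrite -[X in _ --> X](mulr0 (2 * K)) -(normr0 X) -(subrr v).
    by apply: cvgMr; apply: cvg_norm; exact: cvgB.
  rewrite -(cvg_lim _ cvg0) //; apply: limr_ge; first exact: cvgP cvg0.
  exists i.+1 => // m /= im; rewrite -psumB.
  exact: (basis_constant_coef (fun i => a i - b i) nu uK im).
have approx J : exists p : (nat -> R) * nat, `|v - psum u p.1 p.2| < 2^-1 ^+ J.
  have J0 : 0 < 2^-1 ^+ J :> R by rewrite exprn_gt0 // invr_gt0.
  have [_ /lin_spanE[a [n ->]] h] := (closure_distP _ _).1 Vv _ J0.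
  by exists (a, n).
have [c cP] := choice approx.
pose w J := psum u (c J).1 (c J).2.
pose b J := cutoff (c J).2 (c J).1.
have decr J L : (J <= L)%N -> 2^-1 ^+ L <= 2^-1 ^+ J :> R.
  by move=> JL; rewrite ler_wiXn2l // ?invr_ge0 // invf_le1 // ler1n.
have [||||a [aw _]] := @cvg_expansions _ _ u b (fun J => 2 * K * 2^-1 ^+ J) w v nu.
- exact: cvg_half_pow.
- move=> J L n JL; rewrite -psumB.
  pose m := maxn n (maxn (c L).2 (c J).2).
  apply: le_trans (uK.2 _ n m (leq_maxl _ _)) _.
  rewrite psumB !psum_cutoff.
  rewrite (minn_idPr _) ?(minn_idPr _); last 2 first.
  + by rewrite /m !leq_max leqnn !orbT.
  + by rewrite /m !leq_max leqnn !orbT.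
  have := ler_distD v (w L) (w J); rewrite (distrC (w L) v) => h.
  rewrite [leRHS]mulrAC mulrC ler_pM2r // -/(w L) -/(w J).
  have := ltW (cP L); have := ltW (cP J); have := decr _ _ JL; rewrite -/(w L) -/(w J); lra.
- by move=> J; exact: cvg_psum_cutoff.
- apply/cvgrPdist_le => eps eps0.
  have [N _ NP] := (cvgr0Pnorm_le _).1 (cvg_half_pow 1) eps eps0.
  exists N => // n /NP /=; apply: le_trans; apply: le_trans (ltW (cP n)) _.
  by rewrite mul1r ler_norm.
by exists a.
Qed.

End BasisConstant.

(** * The Banach space spanned by a norm on finite sequences *)

(** A seminorm on the finitely supported sequences, coded as polynomials, for
    which the unit vectors 'X^i are normalized and the canonical projections
    are bounded by bn_const; the bound makes it a norm. *)
Record basis_norm (R : realType) := BasisNorm {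
  bn :> {poly R} -> R;
  bn_const : R;
  bnD : forall f g, bn (f + g) <= bn f + bn g;
  bnZ : forall c f, bn (c *: f) = `|c| * bn f;
  bnX : forall i, bn 'X^i = 1;
  bn_take : forall n f, bn (take_poly n f) <= bn_const * bn f
}.

Section BasisSpace.
Variables (R : realType) (p : basis_norm R).
Implicit Types (a b : nat -> R) (f g : {poly R}).

Local Notation K := (bn_const p).
Local Notation tr a n := (\poly_(i < n) a i).

Lemma bn0 : p 0 = 0.
Proof. by rewrite -(scale0r (0 : {poly R})) bnZ normr0 mul0r. Qed.

Lemma bnN f : p (- f) = p f.
Proof. by rewrite -scaleN1r bnZ normrN1 mul1r. Qed.

Lemma bnB f g : p (f - g) <= p f + p g.
Proof. by rewrite -(bnN g) bnD. Qed.

Lemma bn_ge0 f : 0 <= p f.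
Proof. by have := bnB f f; rewrite subrr bn0; lra. Qed.

Lemma bn_const_ge1 : 1 <= K.
Proof.
by have := bn_take p 1 'X^0; rewrite take_poly_id ?size_polyXn // bnX mulr1.
Qed.

Lemma bn_dist f g : `|p f - p g| <= p (f - g).
Proof.
have := bnD p (f - g) g; rewrite subrK => h1.
have := bnD p (g - f) f; rewrite subrK -(bnN (g - f)) opprB => h2.
by rewrite ler_norml; lra.
Qed.

Lemma trD a b n : tr (fun i => a i + b i) n = tr a n + tr b n.
Proof. by apply/polyP => i; rewrite coefD !coef_poly; case: ifP; rewrite ?addr0. Qed.

Lemma trB a b n : tr (fun i => a i - b i) n = tr a n - tr b n.
Proof. by apply/polyP => i; rewrite coefB !coef_poly; case: ifP; rewrite ?subr0. Qed.

Lemma trZ c a n : tr (fun i => c * a i) n = c *: tr a n.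
Proof. by apply/polyP => i; rewrite coefZ !coef_poly; case: ifP; rewrite ?mulr0. Qed.

Lemma tr0 n : tr (fun=> 0) n = 0 :> {poly R}.
Proof. by apply/polyP => i; rewrite coef0 coef_poly; case: ifP. Qed.

Lemma tr_take a n m : (n <= m)%N -> take_poly n (tr a m) = tr a n.
Proof.
move=> nm; apply/polyP => i; rewrite coef_take_poly !coef_poly.
by case: ltnP => // im; rewrite (leq_trans im nm).
Qed.

Lemma trS a n : tr a n.+1 = tr a n + a n *: 'X^n.
Proof.
apply/polyP => i; rewrite coefD coefZ coefXn !coef_poly ltnS leq_eqVlt.
by case: eqVneq => [->|ni] /=; rewrite ?ltnn ?mulr1 ?add0r ?mulr0 ?addr0.
Qed.

Lemma tr_cutoff a n m : (n <= m)%N -> tr (cutoff n a) m = tr a n.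
Proof.
move=> nm; apply/polyP => i; rewrite !coef_poly /cutoff.
by case: (ltnP i n) => [im|]; [rewrite (leq_trans im nm)|rewrite if_same].
Qed.

Lemma bn_tr_le a n m : (n <= m)%N -> p (tr a n) <= K * p (tr a m).
Proof. by move=> nm; rewrite -(tr_take a nm) bn_take. Qed.

Lemma bn_tr_sum a n : p (tr a n) <= \sum_(0 <= i < n) `|a i|.
Proof.
elim: n => [|n IH]; first by rewrite big_nil poly_def big_ord0 bn0.
by rewrite trS big_nat_recr //= (le_trans (bnD _ _ _)) // bnZ bnX mulr1 lerD2r.
Qed.

(** The sequences whose partial sums are Cauchy for p. *)
Definition basis_space_pred : {pred nat -> R} := fun a =>
  `[< forall eps : R, 0 < eps -> exists N, forall n, (N <= n)%N ->
        p (tr a n - tr a N) <= eps >].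

Lemma basis_spaceP a : reflect (forall eps : R, 0 < eps -> exists N, forall n m,
    (N <= n)%N -> (N <= m)%N -> p (tr a n - tr a m) <= eps)
  (a \in basis_space_pred).
Proof.
apply: (iffP (asboolP _)) => aP eps eps0; last first.
  by have [N NP] := aP eps eps0; exists N => n Nn; exact: NP.
have [|N NP] := aP (eps / 2); first by rewrite divr_gt0.
exists N => n m Nn Nm; have := bnB (tr a n - tr a N) (tr a m - tr a N).
by rewrite opprB addrA subrK; have := NP n Nn; have := NP m Nm; lra.
Qed.

Lemma basis_space_submod : submod_closed basis_space_pred.
Proof.
split.
  apply/basis_spaceP => eps eps0; exists 0%N => n m _ _.
  by rewrite (tr0 n) (tr0 m) subrr bn0 ltW.
move=> c a b /basis_spaceP aP /basis_spaceP bP; apply/basis_spaceP => eps eps0.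
have c0 : 0 < `|c| + 1 by rewrite ltr_wpDl.
have [|N NP] := aP (eps / 2 / (`|c| + 1)); first by rewrite !divr_gt0.
have [|M MP] := bP (eps / 2); first by rewrite divr_gt0.
exists (maxn N M) => n m; rewrite !geq_max => /andP[Nn Mn] /andP[Nm Mm].
have trE k : tr (c *: a + b) k = c *: tr a k + tr b k by rewrite -trZ -trD.
rewrite !trE opprD addrACA -scalerBr; apply: le_trans (bnD _ _ _) _.
rewrite bnZ; have h := MP n m Mn Mm.
have := NP n m Nn Nm; rewrite ler_pdivlMr // => h2.
have := bn_ge0 (tr a n - tr a m); have := normr_ge0 c.
nra.
Qed.

HB.instance Definition _ :=
  GRing.isSubmodClosed.Build R (nat -> R) basis_space_pred basis_space_submod.

(** The completion of the finite sequences for p: as the coordinates are bounded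
    functionals, its elements are identified with sequences of reals. *)
Record basis_space := BasisSpace {
  coord :> nat -> R;
  coordP : coord \in basis_space_pred
}.

HB.instance Definition _ := [isSub for coord].
HB.instance Definition _ := [Choice of basis_space by <:].
HB.instance Definition _ := [SubChoice_isSubLmodule of basis_space by <:].

Lemma coordD (u v : basis_space) i : coord (u + v) i = u i + v i.
Proof. by []. Qed.

Lemma coordB (u v : basis_space) i : coord (u - v) i = u i - v i.
Proof. by []. Qed.

Lemma coordZ c (v : basis_space) i : coord (c *: v) i = c * v i.
Proof. by []. Qed.

Definition basis_space_norm (v : basis_space) : R :=
  lim ((fun n => p (tr (coord v) n)) @ \oo).

Lemma cvg_basis_space_norm (v : basis_space) :
  (fun n => p (tr (coord v) n)) @ \oo --> basis_space_norm v.
Proof.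
apply/cauchy_cvgP/cauchy_exP => eps eps0.
have [|N NP] := basis_spaceP _ (coordP v) (eps / 2); first by rewrite divr_gt0.
exists (p (tr (coord v) N)), N => // n /= Nn.
rewrite /ball/= (le_lt_trans (bn_dist _ _)) //.
by apply: le_lt_trans (NP N n (leqnn _) Nn) _; lra.
Qed.

Lemma basis_space_norm_le (v : basis_space) (M : R) (N : nat) :
  (forall n, (N <= n)%N -> p (tr (coord v) n) <= M) -> basis_space_norm v <= M.
Proof.
move=> vM; apply: limr_le; first exact: cvgP (@cvg_basis_space_norm v).
by exists N.
Qed.

Lemma basis_space_norm_tr (v : basis_space) n : p (tr (coord v) n) <= K * basis_space_norm v.
Proof.
have K0 : 0 < K by apply: lt_le_trans bn_const_ge1.
rewrite mulrC -ler_pdivrMr //; apply: limr_ge.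
  exact: cvgP (@cvg_basis_space_norm v).
by exists n => // m /= nm; rewrite ler_pdivrMr // mulrC bn_tr_le.
Qed.

Lemma basis_space_norm_coef (v : basis_space) i : `|v i| <= 2 * K * basis_space_norm v.
Proof.
have -> : `|v i| = p (tr (coord v) i.+1 - tr (coord v) i).
  by rewrite trS addrC addKr bnZ bnX mulr1.
apply: le_trans (bnB _ _) _.
have := basis_space_norm_tr v i; have := basis_space_norm_tr v i.+1; lra.
Qed.

Lemma basis_space_normD (u v : basis_space) :
  basis_space_norm (u + v) <= basis_space_norm u + basis_space_norm v.
Proof.
have uv : (fun n => p (tr (coord u) n) + p (tr (coord v) n)) @ \oo -->
    basis_space_norm u + basis_space_norm v.
  by apply: cvgD; exact: cvg_basis_space_norm.
rewrite -(cvg_lim _ uv) //; apply: ler_lim; [|exact: cvgP uv|].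
  exact: cvgP (@cvg_basis_space_norm (u + v)).
by apply: nearW => n /=; rewrite (trD u v) bnD.
Qed.

Lemma basis_space_normZ c (v : basis_space) :
  basis_space_norm (c *: v) = `|c| * basis_space_norm v.
Proof.
apply: cvg_lim => //.
rewrite (_ : (fun n => _) = (fun n => `|c| * p (tr (coord v) n))).
  by apply: cvgMr; exact: cvg_basis_space_norm.
by apply/funext => n; rewrite (trZ c v) bnZ.
Qed.

Lemma basis_space_norm_eq0 (v : basis_space) : basis_space_norm v = 0 -> v = 0.
Proof.
move=> v0; apply: val_inj; apply/funext => i /=; apply/eqP.
by rewrite -normr_le0 -(mulr0 (2 * K)) -v0 basis_space_norm_coef.
Qed.

HB.instance Definition _ := @Lmodule_isNormed.Build R basis_space
  basis_space_norm basis_space_normD basis_space_normZ basis_space_norm_eq0.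

Lemma basis_space_normE (v : basis_space) : `|v| = basis_space_norm v.
Proof. by []. Qed.

Lemma basis_space_complete (F : set_system basis_space) :
  ProperFilter F -> cauchy F -> cvg F.
Proof.
move=> PF /cauchyP Fc; have K1 := bn_const_ge1.
have K0 : 0 < K by apply: lt_le_trans K1.
have near_b (eps : R) : 0 < eps -> exists b : basis_space, F [set c : basis_space | `|c - b| <= eps].
  move=> eps0; have [b Fb] := Fc _ eps0; exists b; apply: filterS Fb => c.
  by rewrite -ball_normE /= distrC => /ltW.
have coord_cvg i : cvg ((fun c : basis_space => (c i : R)) @ F).
  apply: R_complete; apply: cauchy_exP => eps eps0.
  have [|b Fb] := near_b (eps / (4 * K)); first by rewrite divr_gt0 ?mulr_gt0.
  suff Fi : F [set c : basis_space | `|b i - c i| < eps] by exists (b i); exact: Fi.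
  apply: filterS Fb => c /= cb; rewrite distrC; have := basis_space_norm_coef (c - b) i.
  rewrite coordB -basis_space_normE => h; apply: le_lt_trans h _.
  move: cb; rewrite ler_pdivlMr ?mulr_gt0 // => cb; nra.
pose a i : R := lim ((fun c : basis_space => (c i : R)) @ F).
(* The coordinates of the elements of F converge to those of a, hence so do the
   truncations at n in the norm p. *)
have sum0 n : (fun c : basis_space => \sum_(0 <= i < n) `|a i - c i|) @ F --> (0 : R).
  elim: n => [|n IH].
    by under eq_fun do rewrite big_nil; exact: cvg_cst.
  have cvg_n : (fun c : basis_space => `|a n - c n|) @ F --> `|a n - a n|.
    by apply: cvg_norm; apply: cvgB; [exact: cvg_cst|exact: coord_cvg].
  rewrite subrr normr0 in cvg_n.
  under eq_fun do rewrite big_nat_recr //=.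
  by have := cvgD IH cvg_n; rewrite [X in _ --> X]addr0; exact.
have a_b (eps : R) (b : basis_space) n : 0 < eps ->
    F [set c : basis_space | `|c - b| <= eps] ->
    p (tr a n - tr (coord b) n) <= 2 * K * eps.
  move=> eps0 Fb.
  have Fs : F [set c : basis_space | \sum_(0 <= i < n) `|a i - c i| <= eps].
    apply: (@filterS _ F _ _ _ _ ((cvgr0Pnorm_le _).1 (sum0 n) eps eps0)) => c /=.
    by apply: le_trans; exact: ler_norm.
  have [c [/= cb ca]] := filter_ex (filterI Fb Fs).
  have h1 := bn_tr_sum (fun i => a i - c i) n.
  have h2 := basis_space_norm_tr (c - b) n.
  rewrite (trB (coord c) (coord b)) -basis_space_normE in h2.
  rewrite trB in h1.
  have := bnD p (tr a n - tr (coord c) n) (tr (coord c) n - tr (coord b) n).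
  rewrite addrA subrK => h3; nra.
have aP : a \in basis_space_pred.
  apply/basis_spaceP => eps eps0.
  have e0 : 0 < eps / (8 * K) by rewrite divr_gt0 ?mulr_gt0.
  have [b Fb] := near_b _ e0.
  have [|N NP] := basis_spaceP _ (coordP b) (eps / 2); first by rewrite divr_gt0.
  exists N => n m Nn Nm.
  have h1 := a_b _ b n e0 Fb; have h2 := a_b _ b m e0 Fb; have h3 := NP n m Nn Nm.
  have eE : 2 * K * (eps / (8 * K)) = eps / 4 by field; rewrite gt_eqF.
  rewrite eE in h1 h2.
  have -> : tr a n - tr a m = (tr a n - tr (coord b) n) +
      (tr (coord b) n - tr (coord b) m) - (tr a m - tr (coord b) m).
    by rewrite opprB !addrA !subrK.
  have := bnB (tr a n - tr (coord b) n + (tr (coord b) n - tr (coord b) m))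
    (tr a m - tr (coord b) m).
  have := bnD p (tr a n - tr (coord b) n) (tr (coord b) n - tr (coord b) m).
  lra.
apply/cvg_ex; exists (BasisSpace aP); apply/cvgrPdist_le => eps eps0.
have e0 : 0 < eps / (4 * K) by rewrite divr_gt0 ?mulr_gt0.
have [b Fb] := near_b _ e0; apply: filterS (Fb) => c /= cb.
have ab : `|BasisSpace aP - b| <= eps / 2.
  rewrite basis_space_normE; apply: (@basis_space_norm_le _ _ 0%N) => n _.
  rewrite (trB a (coord b)); apply: le_trans (a_b _ b n e0 Fb) _.
  by rewrite le_eqVlt; apply/orP; left; apply/eqP; field; rewrite gt_eqF.
have cb2 : `|c - b| <= eps / 2.
  apply: le_trans cb _; rewrite ler_pM2l // lef_pV2 ?posrE ?mulr_gt0 //; lra.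
rewrite distrC in cb2; rewrite [leRHS]splitr.
exact: le_trans (ler_distD b _ _) (lerD ab cb2).
Qed.

HB.instance Definition _ := Uniform_isComplete.Build basis_space basis_space_complete.

(** basis_space as a Banach space. *)
Definition basis_space_type : completeNormedModType R := basis_space.

(** ** The unit vectors *)

Lemma cutoff_basis_space a n : cutoff n a \in basis_space_pred.
Proof.
apply/basis_spaceP => eps eps0; exists n => i j ni nj.
by rewrite !tr_cutoff // subrr bn0 ltW.
Qed.

(** The sequence with 1 at i and 0 elsewhere. *)
Definition unit_vector (i : nat) : basis_space_type :=
  BasisSpace (cutoff_basis_space (fun j => (j == i)%:R) i.+1).

Lemma unit_vectorE i j : unit_vector i j = (j == i)%:R.
Proof. by rewrite /= /cutoff ltnS; case: ltngtP. Qed.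

Lemma psum_unit_vector a n : coord (psum unit_vector a n) = cutoff n a.
Proof.
elim: n => [|n IH]; first by rewrite /psum big_nil; apply/funext => i; rewrite /cutoff.
apply/funext => i; rewrite psumS coordD coordZ IH unit_vectorE /cutoff [in RHS]ltnS [in RHS]leq_eqVlt.
by case: eqVneq => [->|ni] /=; rewrite ?ltnn ?mulr1 ?add0r ?mulr0 ?addr0.
Qed.

Lemma norm_psum_unit_vector a n : `|psum unit_vector a n| = p (tr a n).
Proof.
rewrite basis_space_normE; apply: cvg_lim => //; apply: cvg_near_cst; exists n => // m /= nm.
by rewrite psum_unit_vector tr_cutoff.
Qed.

Lemma unit_vector_normalized : normalized unit_vector.
Proof.
move=> i; pose a j : R := (j == i)%:R.
have ai : a i = 1 by rewrite /a eqxx.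
have a0 j : (j < i)%N -> a j = 0 by move=> ji; rewrite /a ltn_eqF.
have := norm_psum_unit_vector a i.+1; rewrite psumS trS ai !scale1r.
rewrite (eq_psum _ (b := fun=> 0)) // psum0 add0r => ->.
rewrite (_ : tr a i = 0) ?add0r ?bnX //.
by apply/polyP => j; rewrite coef_poly coef0; case: ltnP => // /a0.
Qed.

Lemma unit_vector_basis_constant : basis_constant unit_vector K.
Proof.
split; first by apply: lt_le_trans bn_const_ge1.
by move=> a n m nm; rewrite !norm_psum_unit_vector bn_tr_le.
Qed.

Lemma unit_vector_expansion (v : basis_space_type) :
  psum unit_vector (coord v) @ \oo --> v.
Proof.
apply/cvgrPdist_le => eps eps0.
have [N NP] := basis_spaceP _ (coordP v) _ eps0; exists N => // n /= Nn.
apply: (@basis_space_norm_le _ _ n) => m nm.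
rewrite (trB (coord v) (coord (psum unit_vector (coord v) n))).
rewrite psum_unit_vector tr_cutoff //.
by apply: NP => //; exact: leq_trans nm.
Qed.

Lemma unit_vector_basic : basic_sequence unit_vector.
Proof. exact: basis_constant_basic unit_vector_normalized unit_vector_basis_constant. Qed.

Lemma unit_vector_basis : schauder_basis_of setT unit_vector.
Proof.
split=> // v _; apply: unit_vector_basic.2.
exact: cvg_psum_closure (@unit_vector_expansion v).
Qed.

End BasisSpace.

(** * Constant coefficient blocks *)

(** Nonempty successive finite sets. *)
Definition blocks (A : nat -> {fset nat}) : Prop :=
  (forall i, A i != fset0) /\ forall i, fset_before (A i) (A i.+1).

Lemma blocks_lt A i j : blocks A -> (i < j)%N -> fset_before (A i) (A j).
Proof.
move=> [A0 AS]; elim: j => // j IH; rewrite ltnS leq_eqVlt => /predU1P[->//|ij] k l ki lj.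
by have [h hj] := fset0Pn _ (A0 j); exact: ltn_trans (IH ij _ _ ki hj) (AS j _ _ hj lj).
Qed.

Lemma blocks_ge A i k : blocks A -> k \in A i -> (i <= k)%N.
Proof.
move=> bA; elim: i k => // i IH k kA; have [h hi] := fset0Pn _ (bA.1 i).
by exact: leq_ltn_trans (IH _ hi) (bA.2 i _ _ hi kA).
Qed.

Lemma blocks_shift A N : blocks A -> blocks (fun b => A (N + b)%N).
Proof. by move=> [A0 AS]; split=> // i; rewrite addnS. Qed.

Lemma blocks_bigcup E A : blocks E -> blocks A ->
  blocks (fun i => \bigcup_(j <- A i) E j)%fset.
Proof.
move=> bE bA; split=> [i|i k l].
  have [j jA] := fset0Pn _ (bA.1 i); have [k kE] := fset0Pn _ (bE.1 j).
  by apply/fset0Pn; exists k; apply/bigfcupP; exists j; rewrite ?jA.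
move=> /bigfcupP[j /[!andbT] jA kE] /bigfcupP[j' /[!andbT] j'A lE].
by apply: (blocks_lt bE) kE lE; exact: bA.2 jA j'A.
Qed.

Lemma successive_singletons n N (f : nat -> nat) :
  {homo f : i j / (i < j)%N} -> successive n N (fun b => [fset (N + f b)%N]%fset).
Proof.
move=> fi; split=> [a _|a k _|a b /andP[ab _] i j].
- by apply/fset0Pn; exists (N + f a)%N; rewrite inE.
- by rewrite inE => /eqP ->; exact: leq_addr.
- by rewrite !inE => /eqP -> /eqP ->; rewrite ltn_add2l fi.
Qed.

Lemma successive_le n N N' t : (N <= N')%N -> successive n N' t -> successive n N t.
Proof. by move=> NN [? tN ?]; split=> // a k an /(tN _ _ an); exact: leq_trans. Qed.

Lemma bigmax_fset_lt (F : {fset nat}) L : F != fset0 ->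
  (forall k, k \in F -> (k < L)%N) -> (\max_(k <- F) k < L)%N.
Proof.
move=> /fset0Pn[h hF] FL; have L0 : (0 < L)%N := leq_ltn_trans (leq0n h) (FL _ hF).
rewrite -(prednK L0) ltnS; apply/bigmax_leqP_seq => k kF _.
by rewrite -ltnS prednK // FL.
Qed.

Section ConstantBlocks.
Variables (R : realType) (X : completeNormedModType R) (x : nat -> X) (K : R).
Hypotheses (nx : normalized x) (xK : basis_constant x K).
Implicit Types (F : {fset nat}).

(** The constant coefficient block of x with support F, and its normalization,
    which is 0 when the block vanishes. *)
Definition block_sum F : X := \sum_(k <- F) x k.

Definition block_vector F : X := `|block_sum F|^-1 *: block_sum F.

Lemma psum_indicator F N : (forall k, k \in F -> (k < N)%N) ->
  psum x (fun k => (k \in F)%:R) N = block_sum F.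
Proof.
move=> FN; rewrite /psum (bigID (mem F)) /= addrC big1 ?add0r => [|i /negPf ->].
  rewrite /block_sum; under eq_bigr => i -> do rewrite scale1r.
  rewrite -big_filter; apply: perm_big; apply: uniq_perm; rewrite ?fset_uniq //.
    by rewrite filter_uniq // iota_uniq.
  move=> k; rewrite mem_filter mem_index_iota /=.
  by case: (boolP (k \in F)) => //= /FN.
by rewrite scale0r.
Qed.

Lemma psum_indicator0 F N : (forall k, k \in F -> (N <= k)%N) ->
  psum x (fun k => (k \in F)%:R) N = 0.
Proof.
move=> NF; rewrite -(psum0 x N); apply: eq_psum => i iN.
by case: (boolP (i \in F)) => // /NF; rewrite leqNgt iN.
Qed.

Lemma fset_ub F : exists N, forall k, k \in F -> (k < N)%N.
Proof.
by exists (\max_(k <- F) k).+1 => k kF; rewrite ltnS; exact: leq_bigmax_seq.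
Qed.

Lemma block_sum_neq0 F : F != fset0 -> block_sum F != 0.
Proof.
move=> /fset0Pn[k kF]; have [N FN] := fset_ub F.
rewrite -(psum_indicator FN) -normr_gt0.
have := basis_constant_coef (fun k => (k \in F)%:R) nx xK (FN _ kF).
rewrite kF normr1; have := xK.1; set s := `|_| => K0 h.
have s0 : 0 <= s by exact: normr_ge0.
by rewrite lt_neqAle s0 andbT; apply/eqP => s00; move: h; rewrite -s00 mulr0; lra.
Qed.

Lemma block_vector_norm F : F != fset0 -> `|block_vector F| = 1.
Proof.
move=> /block_sum_neq0 F0; rewrite normrZ normfV normr_id mulVf //.
by rewrite normr_eq0.
Qed.

Lemma psum_sum_coef m N (c : nat -> R) (d : nat -> nat -> R) :
  psum x (fun k => \sum_(0 <= i < m) c i * d i k) N =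
  \sum_(0 <= i < m) c i *: psum x (d i) N.
Proof.
elim: m => [|m IH].
  by rewrite big_nil -(psum0 x N); apply: eq_psum => i _; rewrite big_nil.
rewrite big_nat_recr //= -IH -psumZ -psumD; apply: eq_psum => i _.
by rewrite big_nat_recr.
Qed.

(** The partial sums of a normalized block sequence are partial sums of x. *)
Lemma blocks_basis_constant A : blocks A -> basis_constant (block_vector \o A) K.
Proof.
move=> bA; split=> [|a n m nm]; first exact: xK.1.
(* last n is a strict upper bound of A 0, ..., A n.-1 and a lower bound of the others. *)
pose last n := if n is n'.+1 then (\max_(k <- A n') k).+1 else 0%N.
have lastP i l k : (i < l)%N -> k \in A i -> (k < last l)%N.
  case: l => // l; rewrite !ltnS leq_eqVlt => /predU1P[->|il] kA; first exact: leq_bigmax_seq.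
  have [h hl] := fset0Pn _ (bA.1 l).
  by apply: leq_trans (ltnW (blocks_lt bA il kA hl)) _; exact: leq_bigmax_seq.
have lastN i l k : (l <= i)%N -> k \in A i -> (last l <= k)%N.
  case: l => // l li kA; apply: bigmax_fset_lt => [|h hl]; first exact: bA.1.
  exact: blocks_lt bA li _ _ hl kA.
have last_le l : (l <= m)%N -> (last l <= last m)%N.
  case: l => // l lm; apply: bigmax_fset_lt => [|h hl]; first exact: bA.1.
  exact: lastP lm hl.
pose b k := \sum_(0 <= i < m) (a i / `|block_sum (A i)|) * (k \in A i)%:R.
have bE l : (l <= m)%N -> psum (block_vector \o A) a l = psum x b (last l).
  move=> lm; rewrite psum_sum_coef (big_cat_nat (leq0n l) lm) //= [X in _ + X]big1_seq ?addr0.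
    rewrite [LHS]/psum; apply: eq_big_nat => i /andP[_ il].
    rewrite psum_indicator => [|k]; last exact: lastP.
    by rewrite /= /block_vector scalerA.
  move=> i /=; rewrite mem_index_iota => /andP[li _].
  rewrite psum_indicator0 ?scaler0 // => k; exact: lastN.
by rewrite !bE //; apply: xK.2; exact: last_le.
Qed.

Lemma block_vector_norm_le F : `|block_vector F| <= 1.
Proof.
have [F0|F0] := eqVneq (block_sum F) 0; first by rewrite /block_vector F0 scaler0 normr0.
by rewrite normrZ normfV normr_id mulVf // normr_eq0.
Qed.

End ConstantBlocks.

(** * Stabilized block sequences *)

Section Stabilization.
Variables (R : realType) (X : completeNormedModType R) (x : nat -> X).
Implicit Types (a : nat -> R) (t : nat -> {fset nat}).

(** The norm of the combination with coefficients a of the first n normalized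
    constant coefficient blocks supported by the unions of the E k, k in t b. *)
Definition block_norm (E : nat -> {fset nat}) a n t : R :=
  `|psum (fun b => block_vector x (\bigcup_(k <- t b) E k)%fset) a n|.

Lemma block_norm_dist E (a b : nat -> R) n t :
  `|block_norm E a n t - block_norm E b n t| <= \sum_(0 <= i < n) `|a i - b i|.
Proof.
apply: le_trans (ler_dist_dist _ _) _; apply: psum_dist => i _.
exact: block_vector_norm_le.
Qed.

(** The block Ramsey theorem, applied to the countably many norms with rational
    coefficients, followed by an approximation of the coefficients on a grid. *)
Lemma stabilized_blocks : exists2 E, blocks E & forall n (eps : R), 0 < eps ->
  exists N, forall a, (forall i, (i < n)%N -> `|a i| <= 1) ->
    forall t t', successive n N t -> successive n N t' ->
      `|block_norm E a n t - block_norm E a n t'| <= eps.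
Proof.
pose q i : seq rat := odflt [::] (choice.unpickle i).
pose c (s : seq rat) i : R := ratr (nth 0 s i).
pose g i (s : seq {fset nat}) : R :=
  `|psum (fun b => block_vector x (nth fset0 s b)) (c (q i)) (size (q i))|.
have [|E [E0 ES stab]] := @block_ramsey R (fun i => size (q i)) g
    (fun i => \sum_(0 <= b < size (q i)) `|c (q i) b|).
  move=> i s; rewrite normr_id -[X in `|X|]subr0 -(psum0 (fun b => block_vector x (nth fset0 s b)) (size (q i))).
  under eq_bigr do rewrite -[c _ _]subr0.
  by apply: psum_dist => b _; exact: block_vector_norm_le.
have {}stab (s : seq rat) : exists l, forall eps : R, 0 < eps -> exists N, forall t,
    successive (size s) N t -> `|block_norm E (c s) (size s) t - l| <= eps.
  have [l lP] := stab (choice.pickle s); exists l => eps eps0.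
  have [N NP] := lP eps eps0; exists N => t; move: (NP t).
  rewrite /g /q choice.pickleK /= => NPt /NPt; apply: le_trans.
  rewrite le_eqVlt; apply/orP; left; apply/eqP; congr (`| `| _ | - _|).
  by apply: eq_psum_vect => b bs; rewrite nth_mkseq.
exists E => // n eps eps0.
pose m := (Num.truncn (4 * n%:R / eps)).+1.
have m0 : 0 < m%:R :> R by rewrite ltr0n.
have nm : n%:R * m%:R^-1 <= eps / 4.
  rewrite ler_pdivrMr // mulrAC ler_pdivlMr // -ler_pdivrMl // mulrC [n%:R * _]mulrC.
  exact: ltW (truncnS_gt _).
(* Points of [-1, 1]^n with coordinates in m^-1 Z. *)
pose grid (h : n.-tuple 'I_(2 * m).+1) : seq rat :=
  [seq ((nat_of_ord i)%:R - m%:R) / m%:R | i <- h].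
have sz h : size (grid h) = n by rewrite size_map size_tuple.
have [N NP] : {N : n.-tuple 'I_(2 * m).+1 -> nat & forall h, forall t t',
    successive n (N h) t -> successive n (N h) t' ->
    `|block_norm E (c (grid h)) n t - block_norm E (c (grid h)) n t'| <= eps / 2}.
  apply: (@choice _ _ (fun h N => forall t t', successive n N t -> successive n N t' ->
    `|block_norm E (c (grid h)) n t - block_norm E (c (grid h)) n t'| <= eps / 2)) => h.
  have [l lP] := stab (grid h); have [|N NP] := lP (eps / 4); first by rewrite divr_gt0.
  rewrite sz in NP; exists N => t t' /NP h1 /NP h2.
  by have := ler_distD l (block_norm E (c (grid h)) n t) (block_norm E (c (grid h)) n t');
    rewrite (distrC l); lra.
exists (\max_h N h) => a a1 t t' st st'.
pose h := [tuple of mkseq (fun i => inord (Num.truncn ((a i + 1) * m%:R)) : 'I_(2 * m).+1) n].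
have ch i : (i < n)%N -> `|a i - c (grid h) i| <= m%:R^-1.
  move=> i_n; have := a1 i i_n; rewrite ler_norml => /andP[ai1 ai2].
  have T0 : 0 <= (a i + 1) * m%:R by apply: mulr_ge0 => //; lra.
  have := truncn_itv T0; set T := Num.truncn _ => /andP[T1 T2].
  have Tm : (T < (2 * m).+1)%N.
    rewrite ltnS -(ler_nat R) (le_trans T1) // natrM ler_pM2r //; lra.
  rewrite /c (nth_map ord0) ?size_tuple // nth_mkseq // inordK //.
  rewrite fmorph_div rmorphB /= !ratr_nat.
  rewrite (_ : a i - _ = ((a i + 1) * m%:R - T%:R) / m%:R); last by field; rewrite gt_eqF.
  rewrite normrM normfV (gtr0_norm m0) ler_pdivrMr // mulVf ?gt_eqF //.
  by rewrite ger0_norm ?subr_ge0 // lerBlDl natr1 ltW.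
have dist t0 : `|block_norm E a n t0 - block_norm E (c (grid h)) n t0| <= eps / 4.
  apply: le_trans (block_norm_dist _ _ _ _ _) _; apply: le_trans nm.
  rewrite big_nat; apply: le_trans (ler_sum _ (G := fun=> m%:R^-1) _) _.
    by move=> i /andP[_ /ch].
  by rewrite -big_nat sumr_const_nat subn0 mulr_natl.
have hN : (N h <= \max_h N h)%N by exact: leq_bigmax.
have h3 := NP h t t' (successive_le hN st) (successive_le hN st').
have h1 := dist t; have h2 := dist t'; move: h1 h2 h3.
set u := block_norm E a n t; set v := block_norm E a n t'.
set u' := block_norm E _ n t; set v' := block_norm E _ n t'.
rewrite !ler_norml; lra.
Qed.

End Stabilization.

(** * The common spreading model *)

Section SpreadingModel.
Variables (R : realType) (X : completeNormedModType R) (x : nat -> X) (K : R).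
Hypotheses (nx : normalized x) (xK : basis_constant x K).
Variable E : nat -> {fset nat}.
Hypotheses (bE : blocks E) (stab : forall n (eps : R), 0 < eps ->
  exists N, forall a : nat -> R, (forall i, (i < n)%N -> `|a i| <= 1) ->
    forall t t', successive n N t -> successive n N t' ->
      `|block_norm x E a n t - block_norm x E a n t'| <= eps).
Implicit Types (a : nat -> R) (t : nat -> {fset nat}).

Local Notation block_norm := (block_norm x E).

(** The blocks E N, E N.+1, ..., normalized; their joint behaviour for large N
    determines the spreading model. *)
Definition shifted N : nat -> X := block_vector x \o (fun i => E (N + i)%N).

Lemma shifted_norm N i : `|shifted N i| = 1.
Proof. by apply: (block_vector_norm nx xK); exact: bE.1. Qed.

Lemma shifted_basis_constant N : basis_constant (shifted N) K.
Proof. exact (blocks_basis_constant xK (blocks_shift N bE)). Qed.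

Lemma block_norm_shifted a n N (f : nat -> nat) :
  block_norm a n (fun i => [fset (N + f i)%N]%fset) = `|psum (shifted N \o f) a n|.
Proof.
by congr `| _ |; apply: eq_psum_vect => i _; rewrite big_seq_fset1.
Qed.

Lemma block_normZ c a n t : block_norm (fun i => c * a i) n t = `|c| * block_norm a n t.
Proof. by rewrite /block_norm psumZ normrZ. Qed.

(** Every coefficient sequence is a positive multiple of one whose first n terms
    lie in [-1, 1]. *)
Lemma rescale n a : exists c a', [/\ 0 < c, forall i, a i = c * a' i &
  forall i, (i < n)%N -> `|a' i| <= 1].
Proof.
pose c : R := 1 + \sum_(0 <= i < n) `|a i|.
have s0 : 0 <= \sum_(0 <= i < n) `|a i| by exact: sumr_ge0.
have c0 : 0 < c by rewrite /c; lra.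
exists c, (fun i => a i / c); split => // i; first by rewrite mulrC divfK ?gt_eqF.
move=> i_n; rewrite normrM normfV (gtr0_norm c0) ler_pdivrMr // mul1r.
rewrite /c (bigD1_seq i) ?mem_index_iota ?iota_uniq //= addrCA lerDl.
by rewrite addr_ge0 // sumr_ge0.
Qed.

Lemma cvg_shifted a n : cvg ((fun N => `|psum (shifted N) a n|) @ \oo).
Proof.
have [c [a' [c0 ac a1]]] := rescale n a.
apply/cauchy_cvgP/cauchy_exP => eps eps0.
have [|N NP] := stab n (eps := eps / (2 * c)); first by rewrite divr_gt0 ?mulr_gt0.
exists `|psum (shifted N) a n|, N => // M /= NM.
have sN M' : successive n M' (fun i => [fset (M' + id i)%N]%fset).
  by apply: successive_singletons.
have := NP _ a1 _ _ (sN N) (successive_le NM (sN M)).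
rewrite !block_norm_shifted /ball /= => h.
have aE M' : `|psum (shifted M') a n| = c * `|psum (shifted M') a' n|.
  by rewrite -[c]gtr0_norm // -normrZ -psumZ; congr `| _ |; apply: eq_psum.
rewrite !aE -mulrBr normrM gtr0_norm //.
move: h; rewrite ler_pdivlMr ?mulr_gt0 //; set d := `|_ - _| => h.
have : 0 <= d by exact: normr_ge0.
nra.
Qed.

(** The limit of the norms of a combination of shifted N as N goes to infinity. *)
Definition limit_norm (f : {poly R}) : R :=
  lim ((fun N => `|psum (shifted N) (fun i => f`_i) (size f)|) @ \oo).

Lemma psum_poly (u : nat -> X) (f : {poly R}) n : (size f <= n)%N ->
  psum u (fun i => f`_i) n = psum u (fun i => f`_i) (size f).
Proof.
move=> fn; rewrite -[in RHS](minn_idPr fn) -psum_cutoff; apply: eq_psum => i _.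
by rewrite /cutoff; case: ltnP => // fi; rewrite nth_default.
Qed.

Lemma cvg_limit_norm (f : {poly R}) n : (size f <= n)%N ->
  (fun N => `|psum (shifted N) (fun i => f`_i) n|) @ \oo --> limit_norm f.
Proof.
move=> fn; rewrite /limit_norm.
rewrite (_ : (fun N => _) = (fun N => `|psum (shifted N) (fun i => f`_i) (size f)|)).
  exact: cvg_shifted.
by apply/funext => N; rewrite psum_poly.
Qed.

Lemma cvg_limit_norm_tr a n :
  (fun N => `|psum (shifted N) a n|) @ \oo --> limit_norm (\poly_(i < n) a i).
Proof.
rewrite (_ : (fun N => _) =
  (fun N => `|psum (shifted N) (fun i => (\poly_(i < n) a i)`_i) n|)).
  by apply: cvg_limit_norm; exact: size_poly.
by apply/funext => N; congr `| _ |; apply: eq_psum => i i_n; rewrite coef_poly i_n.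
Qed.

Lemma limit_normD f g : limit_norm (f + g) <= limit_norm f + limit_norm g.
Proof.
pose n := maxn (size f) (size g).
have cf := @cvg_limit_norm f n (leq_maxl _ _).
have cg := @cvg_limit_norm g n (leq_maxr _ _).
have cfg := @cvg_limit_norm (f + g) n (size_polyD _ _).
have c2 : (fun N => `|psum (shifted N) (fun i => f`_i) n| +
    `|psum (shifted N) (fun i => g`_i) n|) @ \oo --> limit_norm f + limit_norm g.
  exact: cvgD.
rewrite -(cvg_lim _ cfg) // -(cvg_lim _ c2) //.
apply: ler_lim; [exact: cvgP cfg|exact: cvgP c2|].
apply: nearW => N /=; rewrite (eq_psum _ (b := fun i => f`_i + g`_i)) => [|i _].
  by rewrite psumD ler_normD.
by rewrite coefD.
Qed.

Lemma limit_normZ c f : limit_norm (c *: f) = `|c| * limit_norm f.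
Proof.
apply: cvg_lim => //; rewrite (_ : (fun N => _) =
    (fun N => `|c| * `|psum (shifted N) (fun i => f`_i) (size f)|)).
  by apply: cvgMr; exact: cvg_limit_norm.
apply/funext => N; rewrite -(psum_poly _ (size_scale_leq _ _)) -normrZ -psumZ.
by congr `| _ |; apply: eq_psum => i _; rewrite coefZ.
Qed.

Lemma limit_normX i : limit_norm 'X^i = 1.
Proof.
apply: cvg_lim => //; apply: cvg_near_cst; apply: nearW => N /=.
rewrite size_polyXn (eq_psum _ (b := fun j => (j == i)%:R)) => [|j _].
  by rewrite psum_delta shifted_norm.
by rewrite coefXn.
Qed.

Lemma limit_norm_take n f : limit_norm (take_poly n f) <= K * limit_norm f.
Proof.
have sz : (size (take_poly n f) <= size f)%N.
  apply/leq_sizeP => j fj; rewrite coef_take_poly; case: ifP => // _.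
  exact: nth_default.
have cf := cvg_limit_norm sz; have cKf : (fun N => K * `|psum (shifted N) (fun i => f`_i)
    (size f)|) @ \oo --> K * limit_norm f by apply: cvgMr; exact: cvg_limit_norm.
rewrite -(cvg_lim _ cf) // -(cvg_lim _ cKf) //.
apply: ler_lim; [exact: cvgP cf|exact: cvgP cKf|apply: nearW => N /=].
rewrite (eq_psum _ (b := cutoff n (fun i => f`_i))) => [|i _].
  by rewrite psum_cutoff; apply: (shifted_basis_constant N).2; exact: geq_minl.
by rewrite coef_take_poly.
Qed.

(** The norm of the spreading model, on finite sequences. *)
Definition spreading_norm : basis_norm R :=
  BasisNorm limit_normD limit_normZ limit_normX limit_norm_take.

Local Notation e := (unit_vector spreading_norm).

Lemma cvg_norm_psum a n : (fun N => `|psum (shifted N) a n|) @ \oo --> `|psum e a n|.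
Proof. by rewrite norm_psum_unit_vector; exact: cvg_limit_norm_tr. Qed.

(** Uniformly in the coefficients from [-1, 1], the norms of combinations of n
    successive blocks far away are close to the norm of the spreading model. *)
Lemma block_norm_approx n (eps : R) : 0 < eps ->
  exists N, forall a, (forall i, (i < n)%N -> `|a i| <= 1) ->
    forall t, successive n N t -> `|block_norm a n t - `|psum e a n| | <= eps.
Proof.
move=> eps0; have [N NP] := stab n eps0; exists N => a a1 t st.
have c : (fun M => `|block_norm a n t - `|psum (shifted M) a n| |) @ \oo -->
    `|block_norm a n t - `|psum e a n| |.
  by apply: cvg_norm; apply: cvgB; [exact: cvg_cst|exact: cvg_norm_psum].
rewrite -(cvg_lim _ c) //; apply: limr_le; first exact: cvgP c.
exists N => // M /= NM; rewrite -(block_norm_shifted a n M id); apply: NP => //.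
by apply: (successive_le NM); exact: successive_singletons.
Qed.

Lemma block_norm_approx_point a n (eps : R) : 0 < eps ->
  exists N, forall t, successive n N t -> `|block_norm a n t - `|psum e a n| | <= eps.
Proof.
move=> eps0; have [c [a' [c0 ac a1]]] := rescale n a.
have [N NP] := block_norm_approx n (divr_gt0 eps0 c0).
exists N => t st; have h := NP _ a1 t st; rewrite (ler_pdivlMr _ _ c0) in h.
rewrite (funext ac) block_normZ psumZ normrZ -mulrBr normrM normr_id.
by rewrite (gtr0_norm c0) mulrC; exact: h.
Qed.

Lemma eq_dist0 (r s : R) : (forall eps : R, 0 < eps -> `|r - s| <= eps) -> r = s.
Proof.
move=> h; apply/eqP; rewrite -subr_eq0 -normr_le0; apply/ler_addgt0Pr => eps eps0.
by rewrite add0r h.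
Qed.

(** A combination of a subsequence u \o f, as a combination of u. *)
Lemma psum_comp (Y : completeNormedModType R) (u : nat -> Y) (f : nat -> nat) a n m :
  (forall i, (i < n)%N -> (f i < m)%N) ->
  psum (u \o f) a n = psum u (fun j => \sum_(0 <= i < n) a i * (j == f i)%:R) m.
Proof.
move=> fm; elim: n fm => [|n IH] fm.
  rewrite [RHS](eq_psum _ (b := fun=> 0)) ?psum0 => [|j _]; last by rewrite big_nil.
  by rewrite /psum big_nil.
rewrite psumS IH => [|i i_n]; last exact: fm (ltnW i_n).
rewrite [RHS](eq_psum _ (b := fun j => \sum_(0 <= i < n) a i * (j == f i)%:R +
  a n * (j == f n)%:R)) => [|j _]; last by rewrite big_nat_recr.
rewrite psumD psumZ; congr (_ + _ *: _).
rewrite /= -(psum_delta u (f n)) -[in LHS](minn_idPr (fm n (ltnSn n))) -psum_cutoff.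
apply: eq_psum => j _; rewrite /cutoff ltnS.
by case: (ltngtP j (f n)).
Qed.

Lemma spreading_norm_spreading (f : nat -> nat) a n :
  {homo f : i j / (i < j)%N} -> `|psum (e \o f) a n| = `|psum e a n|.
Proof.
move=> fi; pose m := (\max_(i < n) f i).+1.
have fm i : (i < n)%N -> (f i < m)%N.
  by move=> i_n; rewrite ltnS (leq_bigmax (Ordinal i_n)).
rewrite (psum_comp _ _ fm).
have := @cvg_norm_psum (fun j => \sum_(0 <= i < n) a i * (j == f i)%:R) m.
set s := `|psum _ _ m| => cs; apply: eq_dist0 => eps eps0.
have c : (fun M => `| `|psum (shifted M \o f) a n| - `|psum e a n| |) @ \oo -->
    `|s - `|psum e a n| |.
  apply: cvg_norm; apply: cvgB; last exact: cvg_cst.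
  rewrite (_ : (fun M => _) = (fun M => `|psum (shifted M)
     (fun j => \sum_(0 <= i < n) a i * (j == f i)%:R) m|)) //.
  by apply/funext => M; rewrite (psum_comp _ _ fm).
have [N NP] := block_norm_approx_point a n eps0.
rewrite -(cvg_lim _ c) //; apply: limr_le; first exact: cvgP c.
exists N => // M /= NM; rewrite -block_norm_shifted; apply: NP.
by apply: (successive_le NM); exact: successive_singletons.
Qed.

Lemma spreading_norm_one_spreading : one_spreading e.
Proof.
split=> [|f fi a]; first exact: unit_vector_basic.
have [n an] := fset_ub (finsupp a).
by rewrite (lincomb_psum e an) (lincomb_psum (e \o f) an) spreading_norm_spreading.
Qed.

(** ** Constant coefficient block sequences *)

Let y j := block_sum x (E j).

Lemma block_sum_bigcup (A : {fset nat}) :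
  \sum_(j <- A) y j = block_sum x (\bigcup_(j <- A) E j)%fset.
Proof.
rewrite /block_sum partition_disjoint_bigfcup //= => i j _ _ ij.
apply/fdisjointP => k ki; apply/negP => kj.
case: (ltngtP i j) ij => // ij _.
  by have := blocks_lt bE ij ki kj; rewrite ltnn.
by have := blocks_lt bE ij kj ki; rewrite ltnn.
Qed.

(** The constant coefficient block sequences of y are those of x along unions of
    the E j. *)
Lemma nccbP z : nccb y z -> exists2 A, blocks A &
  z = block_vector x \o (fun i => \bigcup_(j <- A i) E j)%fset.
Proof.
move=> [A [A0 AS zE]]; exists A => //; apply/funext => i.
by rewrite zE block_sum_bigcup.
Qed.

Section Extension.
Variables (T : Type) (d : T).

(** The extension by the value d of a finite family. *)
Definition extend n (a : 'I_n -> T) (i : nat) : T :=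
  if insub i is Some j then a j else d.

Lemma extendE n (a : 'I_n -> T) (i : 'I_n) : extend a i = a i.
Proof. by rewrite /extend valK. Qed.

End Extension.

Lemma psum_extend (Y : completeNormedModType R) (u : nat -> Y) n (a : 'I_n -> R) (k : 'I_n -> nat) :
  \sum_(i < n) a i *: u (k i) = psum (u \o extend 0%N k) (extend 0 a) n.
Proof. by rewrite /psum big_mkord; apply: eq_bigr => i _; rewrite /= !extendE. Qed.

Lemma successive_extend A n N (k : 'I_n -> nat) : blocks A -> increasing_from N k ->
  successive n N (A \o extend 0%N k).
Proof.
move=> bA [kN ki]; split=> [i _|i j i_n|i j /andP[ij j_n]]; first exact: bA.1.
  rewrite /= -[i]/(nat_of_ord (Ordinal i_n)) extendE => /(blocks_ge bA).
  by apply: leq_trans; exact: kN.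
rewrite /= -[i]/(nat_of_ord (Ordinal (ltn_trans ij j_n))).
rewrite -[j]/(nat_of_ord (Ordinal j_n)) !extendE.
by apply: blocks_lt => //; exact: ki.
Qed.

Lemma block_normE (A : nat -> {fset nat}) n (a : 'I_n -> R) (k : 'I_n -> nat) :
  `|\sum_(i < n) a i *: (block_vector x \o (fun i => \bigcup_(j <- A i) E j)%fset) (k i)| =
  block_norm (extend 0 a) n (A \o extend 0%N k).
Proof. by rewrite psum_extend. Qed.

Lemma nccb_good z : nccb y z -> good z.
Proof.
move=> /nccbP[A bA ->]; have bU := blocks_bigcup bE bA.
have nz : normalized (block_vector x \o (fun i => \bigcup_(j <- A i) E j)%fset).
  by move=> i; exact/(block_vector_norm nx xK)/bU.1.
split=> // [|n a].
  exact: basis_constant_basic nz (blocks_basis_constant xK bU).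
exists `|psum e (extend 0 a) n| => eps eps0.
have [N NP] := block_norm_approx_point (extend 0 a) n eps0.
by exists N => k kN; rewrite block_normE; apply: NP; exact: successive_extend.
Qed.

Lemma nccb_spreading_model z : nccb y z -> spreading_model z e.
Proof.
move=> /nccbP[A bA ->]; split.
- exact: unit_vector_normalized.
- exact: unit_vector_basis.
- exact: spreading_norm_one_spreading.
move=> eps n eps0; have [N NP] := block_norm_approx n eps0.
exists N => a k a1 kN; rewrite block_normE (psum_extend e a (fun i => i)).
rewrite (eq_psum_vect (v := e)) => [|i i_n].
  apply: NP => [i i_n|]; last exact: successive_extend.
  by rewrite -[i]/(nat_of_ord (Ordinal i_n)) extendE ler_norml.
by rewrite /= -[i in LHS]/(nat_of_ord (Ordinal i_n)) extendE.
Qed.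

(** All spreading models of constant coefficient block sequences of y have the
    norm of the unit vectors. *)
Lemma spreading_model_norm (Y : completeNormedModType R) (v : nat -> Y) z a n :
  nccb y z -> spreading_model z v -> `|psum v a n| = `|psum e a n|.
Proof.
move=> zy [_ _ _ zv]; have [_ _ _ ze] := nccb_spreading_model zy.
have [c [a' [c0 ac a1]]] := rescale n a.
rewrite (funext ac) !psumZ !normrZ; congr (_ * _).
apply: eq_dist0 => eps eps0; have e2 : 0 < eps / 2 by rewrite divr_gt0.
have [N NP] := zv _ n e2; have [M MP] := ze _ n e2.
pose k (i : 'I_n) := (maxn N M + i)%N.
have kN : increasing_from (maxn N M) k.
  by split=> [i|i j ij]; [exact: leq_addr|rewrite ltn_add2l].
have kle L : (L <= maxn N M)%N -> increasing_from L k.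
  by move=> LN; split=> [i|]; [exact: leq_trans (kN.1 i)|exact: kN.2].
have a'1 (i : 'I_n) : -1 <= a' i <= 1 by rewrite -ler_norml a1.
have := NP _ _ a'1 (kle _ (leq_maxl _ _)).
have := MP _ _ a'1 (kle _ (leq_maxr _ _)).
rewrite -!(big_mkord xpredT (fun i => a' i *: _ i)) -!/(psum _ _ _).
set s := `|\sum_(i < n) _|; rewrite !ler_norml; lra.
Qed.

Lemma nccb_one_equivalent (Y Y' : completeNormedModType R) (v : nat -> Y)
    (v' : nat -> Y') z z' : nccb y z -> nccb y z' ->
  spreading_model z v -> spreading_model z' v' -> one_equivalent v v'.
Proof.
move=> zy z'y zv z'v' a; have [n an] := fset_ub (finsupp a).
rewrite (lincomb_psum v an) (lincomb_psum v' an).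
by rewrite (spreading_model_norm _ _ zy zv) (spreading_model_norm _ _ z'y z'v').
Qed.

Lemma block_sum_block_basic : block_basic_sequence x y.
Proof.
pose c j : {fsfun nat -> R with 0} := [fsfun k in E j => 1 | 0].
have cE j k : c j k = (k \in E j)%:R by rewrite fsfunE; case: ifP.
have supp j : finsupp (c j) = E j.
  by apply/fsetP => k; rewrite mem_finsupp cE pnatr_eq0 eqb0 negbK.
exists c; split=> j.
- rewrite /lincomb supp; apply: eq_big_seq => k kE.
  by rewrite cE kE scale1r.
- exact/(block_sum_neq0 nx xK)/bE.1.
- by rewrite !supp; exact: bE.2.
Qed.

End SpreadingModel.

(** * Uniqueness of the spreading model *)

Theorem theorem4p2 (R : realType) (X : completeNormedModType R) (x : nat -> X)
    (x_normalized : normalized x) (x_basic : basic_sequence x) :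
  exists y : nat -> X,
    [/\ block_basic_sequence x y,
        forall z : nat -> X, nccb y z -> good z,
        forall z : nat -> X, nccb y z ->
          exists (E : completeNormedModType R) (e : nat -> E),
            spreading_model z e
      & forall (z z' : nat -> X) (E E' : completeNormedModType R)
               (e : nat -> E) (e' : nat -> E'),
          nccb y z -> nccb y z' ->
          spreading_model z e -> spreading_model z' e' ->
          one_equivalent e e'].
Proof.
have [K xK] := basic_basis_constant x_normalized x_basic.
have [E bE stab] := stabilized_blocks x.
exists (fun j => block_sum x (E j)); split.
- exact: (block_sum_block_basic x_normalized xK bE).
- by move=> z; exact: (nccb_good x_normalized xK bE stab).
- move=> z zy; exists (basis_space_type (spreading_norm x_normalized xK bE stab)).
  exists (unit_vector (spreading_norm x_normalized xK bE stab)).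
  exact: nccb_spreading_model.
- move=> z z' Y Y' v v' zy z'y zv z'v'.
  exact: (nccb_one_equivalent x_normalized xK bE stab zy z'y zv z'v').
Qed.
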